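(* Let $n\ge 4$ and let $D_n$ be the tree with vertices $c,u,v,w_1,\dots,w_{n-3}$ and edges $\{c,u\},\{c,v\},\{c,w_1\},\{w_1,w_2\},\dots,\{w_{n-4},w_{n-3}\}$ (viewed on a vertex set identified with $[n]$). Then the two-sided ideal of relations among the edge generators of $\mathcal E_{D_n}$ (the kernel of the map from the free algebra on symbols $X_e$, one per edge $e$, sending $X_e$ to the corresponding $x_{ij}$) is generated by: the quadratic relations $X_e^2$ for each edge $e$ and $X_eX_f-X_fX_e$ for disjoint edges $e,f$; the braid relations $X_{ja}X_{jb}X_{ja}+X_{jb}X_{ja}X_{jb}$ for each pair of edges $\{j,a\},\{j,b\}$ sharing the vertex $j$; and the claw relations $X_{ja}X_{jb}X_{jc'}X_{ja}+X_{jb}X_{jc'}X_{ja}X_{jb}+X_{jc'}X_{ja}X_{jb}X_{jc'}$ for each triple of edges $\{j,a\},\{j,b\},\{j,c'\}$ sharing the vertex $j$, where $X_{ja}$ denotes the symbol mapping to $x_{ja}$. Moreover $$\mathcal H_{D_n}(t)=[n][n-1]\cdot[4][6][8]\cdots[2n-4].$$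
   Context: Let $n\ge 1$. The Fomin–Kirillov algebra $\mathcal E_n$ is the associative $\mathbb Q$-algebra with generators $x_{ij}$ for ordered pairs of distinct $i,j\in[n]$, subject to $x_{ij}=-x_{ji}$, $x_{ij}^2=0$, $x_{ij}x_{kl}=x_{kl}x_{ij}$ for distinct $i,j,k,l$, and $x_{ij}x_{jk}+x_{jk}x_{ki}+x_{ki}x_{ij}=0$ for distinct $i,j,k$. It is graded by degree. For a simple graph $G$ on vertex set $[n]$, $\mathcal E_G$ is the subalgebra of $\mathcal E_n$ generated by the $x_{ij}$ with $\{i,j\}$ an edge of $G$; $\mathcal H_G(t)=\sum_d\dim\mathcal E_G^d\,t^d$, and $[k]=1+t+\cdots+t^{k-1}$. *)

(* Defs.v *)
From HB Require Import structures.
From mathcomp Require Import all_boot all_order all_algebra.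
Set Implicit Arguments. Unset Strict Implicit. Unset Printing Implicit Defensive.
Import GRing.Theory.
Local Open Scope ring_scope.

(* Free associative Q-algebra on a set of symbols T: elements are formal      *)
(* linear combinations of words, represented as lists of (coefficient, word); *)
(* two representatives denote the same element iff all word-coefficients      *)
(* agree (nceq).                                                              *)
Definition ncpoly (T : Type) := seq (rat * seq T).

Section NC.
Variable T : eqType.
Implicit Types p q : ncpoly T.

Definition nccoef p (w : seq T) : rat := \sum_(m <- p | m.2 == w) m.1.
Definition nceq p q := forall w, nccoef p w = nccoef q w.
Definition nc0 : ncpoly T := [::].
Definition ncword (w : seq T) : ncpoly T := [:: (1, w)].
Definition ncX (x : T) : ncpoly T := ncword [:: x].
Definition ncadd p q : ncpoly T := p ++ q.
Definition ncscale (c : rat) p : ncpoly T := [seq (c * m.1, m.2) | m <- p].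
Definition ncopp p := ncscale (-1) p.
Definition ncsub p q := ncadd p (ncopp q).
Definition ncmul p q : ncpoly T :=
  [seq (m.1 * m'.1, m.2 ++ m'.2) | m <- p, m' <- q].
Definition nclin (c : nat -> rat) (bs : seq (ncpoly T)) : ncpoly T :=
  flatten [seq ncscale (c i) (nth nc0 bs i) | i <- iota 0 (size bs)].
Definition nchomog (d : nat) p := all (fun m => size m.2 == d) p.

Inductive in_ideal (R : ncpoly T -> Prop) : ncpoly T -> Prop :=
| ideal_gen r : R r -> in_ideal R r
| ideal_0 : in_ideal R nc0
| ideal_add p q : in_ideal R p -> in_ideal R q -> in_ideal R (ncadd p q)
| ideal_lmul a p : in_ideal R p -> in_ideal R (ncmul a p)
| ideal_rmul p a : in_ideal R p -> in_ideal R (ncmul p a)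
| ideal_eq p q : nceq p q -> in_ideal R p -> in_ideal R q.
End NC.

Definition ncmap (S T : Type) (f : S -> T) (p : ncpoly S) : ncpoly T :=
  [seq (m.1, map f m.2) | m <- p].

(* Fomin--Kirillov algebra E_n = Q<x_ij> / (FK relations).                   *)
Definition fkgen (n : nat) := {p : 'I_n * 'I_n | p.1 != p.2}.

Definition fk_rel (n : nat) (r : ncpoly (fkgen n)) : Prop :=
  (exists a b : fkgen n, [/\ (val b).1 = (val a).2, (val b).2 = (val a).1
                          & r = ncadd (ncX a) (ncX b)])
  \/ (exists a : fkgen n, r = ncmul (ncX a) (ncX a))
  \/ (exists a b : fkgen n,
        [/\ (val a).1 != (val b).1, (val a).1 != (val b).2,
            (val a).2 != (val b).1, (val a).2 != (val b).2
          & r = ncsub (ncmul (ncX a) (ncX b)) (ncmul (ncX b) (ncX a))])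
  \/ (exists a b c : fkgen n,
        [/\ (val a).2 = (val b).1, (val b).2 = (val c).1, (val c).2 = (val a).1
          & r = ncadd (ncadd (ncmul (ncX a) (ncX b)) (ncmul (ncX b) (ncX c)))
                      (ncmul (ncX c) (ncX a))]).
(* (i,j,k are automatically distinct: i<>j, j<>k, k<>i come from a, b, c.) *)

(* A simple graph G on [n] (symmetric irreflexive relation).  Edge symbols:  *)
(* one symbol X_e per edge e = {i,j}, stored as the pair (i,j) with i < j,   *)
(* and X_e is sent to x_ij.                                                  *)
Definition edgesym (n : nat) (G : rel 'I_n) :=
  {p : 'I_n * 'I_n | (p.1 < p.2)%N && G p.1 p.2}.

Lemma esym_neq n (G : rel 'I_n) (e : edgesym G) : (val e).1 != (val e).2.
Proof.
case: e => [[i j]] /= /andP[lt _].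
by apply/negP => /eqP eij; rewrite eij ltnn in lt.
Qed.

Definition esym_gen n (G : rel 'I_n) (e : edgesym G) : fkgen n :=
  exist _ (val e) (esym_neq e).

Definition incident n (G : rel 'I_n) (j : 'I_n) (e : edgesym G) : bool :=
  ((val e).1 == j) || ((val e).2 == j).

(* X_{ja}, for the edge e = {j,a}: the symbol mapping to x_{ja}, i.e. X_e if  *)
(* j is the smaller endpoint, and -X_e otherwise (x_{ja} = -x_{aj}).          *)
Definition Xfrom n (G : rel 'I_n) (j : 'I_n) (e : edgesym G) : ncpoly (edgesym G) :=
  if (val e).1 == j then ncX e else ncopp (ncX e).

Definition graph_rel n (G : rel 'I_n) (r : ncpoly (edgesym G)) : Prop :=
  (exists e : edgesym G, r = ncmul (ncX e) (ncX e))
  \/ (exists e f : edgesym G,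
        (forall j, ~~ (incident j e && incident j f)) /\
        r = ncsub (ncmul (ncX e) (ncX f)) (ncmul (ncX f) (ncX e)))
  \/ (exists (j : 'I_n) (e f : edgesym G),
        [/\ e != f, incident j e, incident j f &
         r = ncadd (ncmul (ncmul (Xfrom j e) (Xfrom j f)) (Xfrom j e))
                   (ncmul (ncmul (Xfrom j f) (Xfrom j e)) (Xfrom j f))])
  \/ (exists (j : 'I_n) (e f g : edgesym G),
        [/\ [&& e != f, f != g & e != g], incident j e, incident j f,
            incident j g &
         r = ncadd (ncadd
               (ncmul (ncmul (ncmul (Xfrom j e) (Xfrom j f)) (Xfrom j g)) (Xfrom j e))
               (ncmul (ncmul (ncmul (Xfrom j f) (Xfrom j g)) (Xfrom j e)) (Xfrom j f)))
               (ncmul (ncmul (ncmul (Xfrom j g) (Xfrom j e)) (Xfrom j f)) (Xfrom j g))]).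

(* dim E_G^d = k : there are k elements of E_G^d (images of homogeneous      *)
(* degree-d polynomials in the edge symbols) forming a basis of E_G^d, i.e.  *)
(* linearly independent in E_n and spanning the images of all degree-d edge  *)
(* words (which span E_G^d).                                                 *)
Definition dimEG n (G : rel 'I_n) (d k : nat) : Prop :=
  exists bs : seq (ncpoly (edgesym G)),
    [/\ size bs = k, all (nchomog d) bs,
        (forall c : nat -> rat,
           in_ideal (@fk_rel n) (ncmap (@esym_gen n G) (nclin c bs)) ->
           forall i, (i < k)%N -> c i = 0)
      & (forall w : seq (edgesym G), size w = d ->
           exists c : nat -> rat,
             in_ideal (@fk_rel n)
               (ncmap (@esym_gen n G) (ncsub (ncword w) (nclin c bs))))].

(* The tree D_n on [n] = {0,...,n-1}: c = 0, u = 1, v = 2, w_k = k + 2;      *)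
(* edges {0,1}, {0,2}, {0,3}, {3,4}, ..., {n-2,n-1}.                         *)
Definition Dadj (a b : nat) : bool :=
  ((a == 0%N) && (b \in [:: 1; 2; 3]%N)) || ((3 <= a)%N && (b == a.+1)).

Definition Dn (n : nat) : rel 'I_n :=
  fun i j => Dadj (val i) (val j) || Dadj (val j) (val i).
Arguments Dn : clear implicits.

Definition qint (k : nat) : {poly int} := \sum_(i < k) 'X^i.

Definition HDn (n : nat) : {poly int} :=
  qint n * qint n.-1 * \prod_(2 <= i < n.-1) qint (2 * i).

(* Main.v *)
Require Import Defs.
From HB Require Import structures.
From mathcomp Require Import all_boot all_order all_algebra.
From mathcomp Require Import generic_quotient boolp zify ring lra.
Set Implicit Arguments. Unset Strict Implicit. Unset Printing Implicit Defensive.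
Import GRing.Theory.

(* Number the edges of D_n so that edge k has larger endpoint k+1; the edges  *)
(* 0, 1, 2 form the claw and 2, 3, ..., n-2 the tail.                         *)
(*   Upper bound.  Modulo the graph relations, for i >= 1, the algebra        *)
(* generated by the edges 0, ..., i+1 is spanned, as a left module over the   *)
(* one generated by 0, ..., i, by 2(i+3) words: the prefixes of               *)
(*   (i+1) ... 3 2 0 1 0 2 3 ... (i+1)                                        *)
(* together with (i+1) ... 3 2 1 and (i+1) ... 3 2 1 0.  The claw relations   *)
(* remove the continuations 2 0 1 2 and 2 1 0 2.                              *)
(*   Lower bound.  E_n carries twisted derivations D_ab with                  *)
(* D_ab (P Q) = D_ab(P) Q + s_ab(P) D_ab(Q).  If P avoids the vertex a, then  *)
(* D_ab(P Q) = s_ab(P) D_ab(Q) and s_ab(P) avoids b, so derivations along a   *)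
(* walk a, b, c, ... starting at the new vertex pass through P.  Each module  *)
(* generator r has a walk of length |r| detecting it among the generators of  *)
(* length at most |r|, whence linear independence.                            *)

(** * The quotient of a free algebra by an ideal *)

(** One family of words, [nwords], serves both bounds. Braid and claw relations follow from the
    triangle relation ([fkx_braid], [fkx_claw]), so the algebra presented by the graph relations
    maps onto E_{D_n}. Using graph relations alone, [wprod_nwords] turns every word into an integer
    combination of normal words of the same length; [nwords_free] together with [fk_ideal_dual]
    shows that the images of the normal words in E_n are independent. Hence a polynomial that
    vanishes in E_n has a zero normal form and lies in the graph ideal ([fk_ideal_graph]), and the
    normal words of length d give a basis in degree d ([dimEG_nwords]). Spanning rests on the left
    module generated by [reps i] being closed under right multiplication ([wprod_mulr]). The
    delicate generator is the longest one: it commutes with the earlier edges up to exchanging edges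
    0 and 1 ([wprod_top]), which is where the claw relation enters ([claw_twist]). Independence uses
    no model of E_n. The operators [op] satisfy the Fomin-Kirillov relations ([fk_ideal_opw]), so
    each sequence of derivations gives a functional on E_n, and walks make the resulting matrix
    triangular ([reps_walk]). Finally [reps i] contributes the factor [i+3](1 + t^(i+1)), and [k](1
    + t^k) = [2k] turns the product into the stated series. *)

Section LinearExtension.
Local Open Scope ring_scope.
Variables (T : eqType) (V : lmodType rat).
Implicit Types (p q : ncpoly T) (phi : seq T -> V).

(** Linear extension of a function on words. It respects [nceq], and scalar-valued extensions
    separate [nceq] classes ([nceq_lin]), so identities of formal polynomials are checked as
    identities of sums. *)
Definition lin phi p : V := \sum_(m <- p) m.1 *: phi m.2.

Lemma lin_add phi p q : lin phi (ncadd p q) = lin phi p + lin phi q.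
Proof. exact: big_cat. Qed.

Lemma lin_scale phi c p : lin phi (ncscale c p) = c *: lin phi p.
Proof.
by rewrite /lin big_map scaler_sumr; apply: eq_bigr => m _; rewrite scalerA.
Qed.

Lemma lin_opp phi p : lin phi (ncopp p) = - lin phi p.
Proof. by rewrite lin_scale scaleN1r. Qed.

Lemma lin_sub phi p q : lin phi (ncsub p q) = lin phi p - lin phi q.
Proof. by rewrite lin_add lin_opp. Qed.

Lemma lin_word phi w : lin phi (ncword w) = phi w.
Proof. by rewrite /lin big_seq1 scale1r. Qed.

Lemma lin0 phi : lin phi (nc0 T) = 0.
Proof. exact: big_nil. Qed.

Lemma lin_mul phi p q :
  lin phi (ncmul p q) =
  \sum_(m <- p) \sum_(m' <- q) (m.1 * m'.1) *: phi (m.2 ++ m'.2).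
Proof. by rewrite /lin big_allpairs_dep. Qed.

Lemma lin_nclin phi c bs :
  lin phi (nclin c bs) = \sum_(i < size bs) c i *: lin phi (nth (nc0 T) bs i).
Proof.
rewrite -(big_mkord xpredT (fun i => c i *: lin phi (nth (nc0 T) bs i))).
rewrite /nclin /index_iota subn0.
elim: (iota _ _) => [|i s IH] /=; first by rewrite big_nil lin0.
by rewrite big_cons -IH -lin_scale -lin_add.
Qed.

Lemma lin_support phi p (s : seq (seq T)) :
  uniq s -> {subset [seq m.2 | m <- p] <= s} ->
  lin phi p = \sum_(w <- s) nccoef p w *: phi w.
Proof.
move=> us sub; rewrite /nccoef.
under eq_bigr => w _ do rewrite scaler_suml big_mkcond /=.
rewrite exchange_big /=; apply: eq_big_seq => m pm.
rewrite (bigD1_seq m.2) ?us ?sub ?map_f //= eqxx.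
by rewrite big1 ?addr0 // => w; rewrite eq_sym => /negPf->.
Qed.

Lemma lin_nceq phi p q : nceq p q -> lin phi p = lin phi q.
Proof.
move=> e; pose s := undup [seq m.2 | m <- p ++ q].
have us : uniq s by apply: undup_uniq.
rewrite !(@lin_support phi _ s) //.
- by apply: eq_bigr => w _; rewrite e.
- by move=> w wq; rewrite mem_undup map_cat mem_cat wq orbT.
- by move=> w wp; rewrite mem_undup map_cat mem_cat wp.
Qed.

End LinearExtension.

Lemma nccoef_lin (T : eqType) (p : ncpoly T) w :
  nccoef p w = lin (V := rat^o) (fun v => ((v == w)%:R)%R) p.
Proof.
rewrite /nccoef /lin big_mkcond; apply: eq_bigr => m _.
by case: eqP => _; rewrite /GRing.scale /= ?mulr1 ?mulr0.
Qed.

Lemma nceq_lin (T : eqType) (p q : ncpoly T) :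
  (forall phi : seq T -> rat^o, lin phi p = lin phi q) -> nceq p q.
Proof. by move=> e w; rewrite !nccoef_lin e. Qed.

Lemma in_ideal_lin (T : eqType) R (p q : ncpoly T) :
  (forall phi : seq T -> rat^o, lin phi p = lin phi q) ->
  in_ideal R p -> in_ideal R q.
Proof. by move=> e; apply: ideal_eq; apply: nceq_lin. Qed.

Section Quotient.
Local Open Scope ring_scope.
Local Open Scope quotient_scope.
Variables (T : choiceType) (R : ncpoly T -> Prop).
Implicit Types p q r : ncpoly T.
Local Notation I := (in_ideal R).
Local Notation wd := (ncword (T := T)).

Lemma ideal_scale c p : I p -> I (ncscale c p).
Proof.
move=> /(@ideal_lmul _ _ (ncscale c (ncword [::]))); apply: in_ideal_lin => phi.
rewrite lin_scale lin_mul /= big_seq1 /lin /= scaler_sumr; apply: eq_bigr => m _.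
by rewrite mulr1 scalerA.
Qed.

Definition ideal_cong p q : bool := `[< I (ncsub p q) >].

Lemma ideal_congP p q : reflect (I (ncsub p q)) (ideal_cong p q).
Proof. exact: asboolP. Qed.

Lemma ideal_cong_refl : reflexive ideal_cong.
Proof.
move=> p; apply/ideal_congP; apply: in_ideal_lin (ideal_0 R) => phi.
by rewrite lin_sub subrr lin0.
Qed.

Lemma ideal_cong_sym : symmetric ideal_cong.
Proof.
move=> p q; apply/ideal_congP/ideal_congP => /(ideal_scale (-1));
  by apply: in_ideal_lin => phi; rewrite lin_opp !lin_sub opprB.
Qed.

Lemma ideal_cong_trans : transitive ideal_cong.
Proof.
move=> q p r /ideal_congP pq /ideal_congP qr; apply/ideal_congP.
apply: in_ideal_lin (ideal_add pq qr) => phi.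
by rewrite lin_add !lin_sub addrA subrK.
Qed.

Canonical ideal_equiv :=
  EquivRel ideal_cong ideal_cong_refl ideal_cong_sym ideal_cong_trans.

Definition ncquot := {eq_quot ideal_cong}.
HB.instance Definition _ : EqQuotient _ ideal_cong ncquot := EqQuotient.on ncquot.
HB.instance Definition _ := Choice.on ncquot.

Lemma ncquot_eqP p q :
  (forall phi : seq T -> rat^o, lin phi p = lin phi q) -> p = q %[mod ncquot].
Proof.
move=> e; apply/eqmodP/ideal_congP; apply: in_ideal_lin (ideal_0 R) => phi.
by rewrite lin_sub e subrr lin0.
Qed.

Definition qadd := lift_op2 ncquot (@ncadd T).
Lemma pi_qadd : {morph \pi : p q / ncadd p q >-> qadd p q}.
Proof.
move=> p q; unlock qadd; apply/eqmodP/ideal_congP => /=.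
set p' := repr _; set q' := repr _.
have /eqmodP/ideal_congP ep : p = p' %[mod ncquot] by rewrite reprK.
have /eqmodP/ideal_congP eq : q = q' %[mod ncquot] by rewrite reprK.
apply: in_ideal_lin (ideal_add ep eq) => phi.
by rewrite !(lin_add, lin_sub) opprD addrACA.
Qed.
Canonical pi_qadd_morph := PiMorph2 pi_qadd.

Definition qopp := lift_op1 ncquot (@ncopp T).
Lemma pi_qopp : {morph \pi : p / ncopp p >-> qopp p}.
Proof.
move=> p; unlock qopp; apply/eqmodP/ideal_congP => /=.
set p' := repr _.
have /eqmodP/ideal_congP ep : p = p' %[mod ncquot] by rewrite reprK.
apply: in_ideal_lin (ideal_scale (-1) ep) => phi.
by rewrite !(lin_opp, lin_sub) opprB opprK addrC.
Qed.
Canonical pi_qopp_morph := PiMorph1 pi_qopp.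

Definition qscale c := lift_op1 ncquot (@ncscale T c).
Lemma pi_qscale c : {morph \pi : p / ncscale c p >-> qscale c p}.
Proof.
move=> p; unlock qscale; apply/eqmodP/ideal_congP => /=.
set p' := repr _.
have /eqmodP/ideal_congP ep : p = p' %[mod ncquot] by rewrite reprK.
apply: in_ideal_lin (ideal_scale c ep) => phi.
by rewrite !(lin_scale, lin_sub) scalerBr.
Qed.
Canonical pi_qscale_morph c := PiMorph1 (pi_qscale c).

Definition qmul := lift_op2 ncquot (@ncmul T).
Lemma pi_qmul : {morph \pi : p q / ncmul p q >-> qmul p q}.
Proof.
move=> p q; unlock qmul; apply/eqmodP/ideal_congP => /=.
set p' := repr _; set q' := repr _.
have /eqmodP/ideal_congP ep : p = p' %[mod ncquot] by rewrite reprK.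
have /eqmodP/ideal_congP eq : q = q' %[mod ncquot] by rewrite reprK.
(* Splitting used here: p q - p' q' = p (q - q') + (p - p') q'. *)
apply: in_ideal_lin (ideal_add (ideal_lmul p eq) (ideal_rmul q' ep)) => phi.
rewrite lin_add !lin_sub !lin_mul !big_cat /= !big_map.
under eq_bigr => m _ do rewrite big_cat big_map /=.
rewrite big_split /= -addrA; congr (_ + _).
rewrite addrA -big_split /= big1 ?add0r.
  rewrite -sumrN; apply: eq_bigr => m _; rewrite -sumrN; apply: eq_bigr => m' _.
  by rewrite mulN1r mulNr scaleNr.
move=> m _; rewrite -big_split /= big1 // => m' _.
by rewrite mulN1r mulrN scaleNr addNr.
Qed.
Canonical pi_qmul_morph := PiMorph2 pi_qmul.

Lemma qaddA : associative qadd.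
Proof.
elim/quotW=> p; elim/quotW=> q; elim/quotW=> r; rewrite !piE.
by apply: ncquot_eqP => phi; rewrite !lin_add addrA.
Qed.
Lemma qaddC : commutative qadd.
Proof.
elim/quotW=> p; elim/quotW=> q; rewrite !piE.
by apply: ncquot_eqP => phi; rewrite !lin_add addrC.
Qed.
Lemma qadd0 : left_id (\pi_ncquot (nc0 T)) qadd.
Proof. by elim/quotW=> p; rewrite !piE. Qed.
Lemma qaddN : left_inverse (\pi_ncquot (nc0 T)) qopp qadd.
Proof.
elim/quotW=> p; rewrite !piE.
by apply: ncquot_eqP => phi; rewrite lin_add lin_opp addNr lin0.
Qed.
HB.instance Definition _ := GRing.isZmodule.Build ncquot qaddA qaddC qadd0 qaddN.

Lemma qmulA : associative qmul.
Proof.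
elim/quotW=> p; elim/quotW=> q; elim/quotW=> r; rewrite !piE.
apply: ncquot_eqP => phi; rewrite !lin_mul big_allpairs_dep.
apply: eq_bigr => m _; rewrite big_allpairs_dep; apply: eq_bigr => m' _.
by apply: eq_bigr => m'' _ /=; rewrite mulrA catA.
Qed.
Lemma qmul1 : left_id (\pi_ncquot (wd [::])) qmul.
Proof.
elim/quotW=> p; rewrite !piE; apply: ncquot_eqP => phi; rewrite lin_mul.
by rewrite big_seq1; apply: eq_bigr => m _; rewrite mul1r.
Qed.
Lemma qmulr1 : right_id (\pi_ncquot (wd [::])) qmul.
Proof.
elim/quotW=> p; rewrite !piE; apply: ncquot_eqP => phi; rewrite lin_mul.
by apply: eq_bigr => m _; rewrite big_seq1 mulr1 cats0.
Qed.
Lemma qmulDl : left_distributive qmul qadd.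
Proof.
elim/quotW=> p; elim/quotW=> q; elim/quotW=> r; rewrite !piE.
by apply: ncquot_eqP => phi; rewrite lin_add !lin_mul big_cat.
Qed.
Lemma qmulDr : right_distributive qmul qadd.
Proof.
elim/quotW=> p; elim/quotW=> q; elim/quotW=> r; rewrite !piE.
apply: ncquot_eqP => phi; rewrite lin_add !lin_mul -big_split /=.
by apply: eq_bigr => m _; rewrite big_cat.
Qed.
HB.instance Definition _ :=
  GRing.Zmodule_isPzRing.Build ncquot qmulA qmul1 qmulr1 qmulDl qmulDr.

Lemma qscaleA a b v : qscale a (qscale b v) = qscale (a * b) v.
Proof.
elim/quotW: v => p; rewrite !piE.
by apply: ncquot_eqP => phi; rewrite !lin_scale scalerA.
Qed.
Lemma qscale1 : left_id 1 qscale.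
Proof.
elim/quotW=> p; rewrite !piE.
by apply: ncquot_eqP => phi; rewrite !lin_scale scale1r.
Qed.
Lemma qscaleDr : right_distributive qscale qadd.
Proof.
move=> c; elim/quotW=> p; elim/quotW=> q; rewrite !piE.
by apply: ncquot_eqP => phi; rewrite !(lin_add, lin_scale) scalerDr.
Qed.
Lemma qscaleDl v : {morph qscale^~ v : a b / a + b >-> qadd a b}.
Proof.
elim/quotW: v => p a b; rewrite !piE.
by apply: ncquot_eqP => phi; rewrite !(lin_add, lin_scale) scalerDl.
Qed.
HB.instance Definition _ :=
  GRing.Zmodule_isLmodule.Build rat ncquot qscaleA qscale1 qscaleDr qscaleDl.

Definition ncpi p : ncquot := \pi_ncquot p.

Lemma ncpi_add p q : ncpi (ncadd p q) = ncpi p + ncpi q.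
Proof. exact: pi_qadd. Qed.
Lemma ncpi_opp p : ncpi (ncopp p) = - ncpi p.
Proof. exact: pi_qopp. Qed.
Lemma ncpi_sub p q : ncpi (ncsub p q) = ncpi p - ncpi q.
Proof. by rewrite ncpi_add ncpi_opp. Qed.
Lemma ncpi_mul p q : ncpi (ncmul p q) = ncpi p * ncpi q.
Proof. exact: pi_qmul. Qed.
Lemma ncpi_scale c p : ncpi (ncscale c p) = c *: ncpi p.
Proof. exact: pi_qscale. Qed.

Lemma ncpi_eq0 p : ncpi p = 0 <-> I p.
Proof.
split=> [/eqmodP/ideal_congP | Ip].
  by apply: in_ideal_lin => phi; rewrite lin_sub lin0 subr0.
apply/eqmodP/ideal_congP; apply: in_ideal_lin Ip => phi.
by rewrite lin_sub lin0 subr0.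
Qed.

Lemma ncpi_word w : ncpi (wd w) = \prod_(x <- w) ncpi (ncX x).
Proof.
elim: w => [|x w IH]; first by rewrite big_nil.
rewrite big_cons -IH -ncpi_mul; apply: ncquot_eqP => phi.
by rewrite [RHS]lin_mul !big_seq1 mul1r lin_word scale1r.
Qed.

Lemma ncpi_lin p : ncpi p = lin (fun w => ncpi (wd w)) p.
Proof.
rewrite /lin; elim: p => [|[c w] p IH]; first by rewrite big_nil.
rewrite big_cons -IH /= -ncpi_scale -ncpi_add; apply: ncquot_eqP => phi.
by rewrite lin_add lin_scale lin_word /lin big_cons.
Qed.

End Quotient.

(** * Braid and claw relations in the Fomin--Kirillov algebra *)

Section Ncmap.
Local Open Scope ring_scope.
Variables (S T : eqType) (f : S -> T).
Implicit Types p q : ncpoly S.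

Lemma ncmap_add p q : ncmap f (ncadd p q) = ncadd (ncmap f p) (ncmap f q).
Proof. exact: map_cat. Qed.

Lemma ncmap_scale c p : ncmap f (ncscale c p) = ncscale c (ncmap f p).
Proof. by rewrite /ncmap /ncscale -!map_comp. Qed.

Lemma ncmap_sub p q : ncmap f (ncsub p q) = ncsub (ncmap f p) (ncmap f q).
Proof. by rewrite ncmap_add ncmap_scale. Qed.

Lemma ncmap_mul p q : ncmap f (ncmul p q) = ncmul (ncmap f p) (ncmap f q).
Proof.
rewrite /ncmap /ncmul map_allpairs allpairs_mapl allpairs_mapr.
by apply: eq_allpairs => m m' /=; rewrite map_cat.
Qed.

Lemma lin_ncmap (V : lmodType rat) (phi : seq T -> V) p :
  lin phi (ncmap f p) = lin (phi \o map f) p.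
Proof. by rewrite /lin big_map. Qed.

Lemma ncmap_nceq p q : nceq p q -> nceq (ncmap f p) (ncmap f q).
Proof. by move=> e; apply: nceq_lin => phi; rewrite !lin_ncmap; apply: lin_nceq. Qed.

End Ncmap.

Section FominKirillov.
Local Open Scope ring_scope.
Variable n : nat.
Local Notation E := (ncquot (@fk_rel n)).
Local Notation ncpi := (@ncpi _ (@fk_rel n)).

(** Made total by the value 0 on the diagonal, so that vertices need not carry distinctness
    proofs. *)
Definition fkx (i j : 'I_n) : E :=
  oapp (fun a : fkgen n => ncpi (ncX a)) 0 (insub (i, j)).

Lemma fkxE (a : fkgen n) : ncpi (ncX a) = fkx (val a).1 (val a).2.
Proof. by rewrite /fkx -surjective_pairing valK. Qed.

Lemma fkx_gen i j : i != j ->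
  exists2 a : fkgen n, val a = (i, j) & fkx i j = ncpi (ncX a).
Proof.
move=> ij; pose a : fkgen n := exist _ (i, j) ij.
by exists a => //; rewrite fkxE.
Qed.

Lemma fkx_anti i j : i != j -> fkx j i = - fkx i j.
Proof.
move=> ij; have [a va ->] := fkx_gen ij.
rewrite eq_sym in ij; have [b vb ->] := fkx_gen ij.
apply/eqP; rewrite -addr_eq0 -ncpi_add; apply/eqP/ncpi_eq0/ideal_gen.
by left; exists b, a; rewrite va vb.
Qed.

Lemma fkx_sq i j : i != j -> fkx i j * fkx i j = 0.
Proof.
move=> /fkx_gen[a _ ->]; rewrite -ncpi_mul; apply/ncpi_eq0/ideal_gen.
by right; left; exists a.
Qed.

Lemma fkx_comm i j k l : i != j -> k != l ->
  i != k -> i != l -> j != k -> j != l -> fkx i j * fkx k l = fkx k l * fkx i j.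
Proof.
move=> /fkx_gen[a va ->] /fkx_gen[b vb ->] ik il jk jl.
apply/eqP; rewrite -subr_eq0 -!ncpi_mul -ncpi_sub; apply/eqP/ncpi_eq0/ideal_gen.
by right; right; left; exists a, b; rewrite va vb.
Qed.

Lemma fkx_triangle i j k : i != j -> j != k -> k != i ->
  fkx i j * fkx j k + fkx j k * fkx k i + fkx k i * fkx i j = 0.
Proof.
move=> /fkx_gen[a va ->] /fkx_gen[b vb ->] /fkx_gen[c vc ->].
rewrite -!ncpi_mul -!ncpi_add; apply/ncpi_eq0/ideal_gen.
by right; right; right; exists a, b, c; rewrite va vb vc.
Qed.

(** The triangle relation on j, b, a, with every generator reoriented to start at j or to be
    x_ab. *)
Lemma fkx_star j a b : j != a -> j != b -> a != b ->
  fkx j a * fkx j b = fkx a b * fkx j a - fkx j b * fkx a b.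
Proof.
move=> ja jb ab.
have ba : b != a by rewrite eq_sym.
have aj : a != j by rewrite eq_sym.
have /eqP := fkx_triangle jb ba aj.
rewrite (fkx_anti ja) (fkx_anti ab) !(mulrN, mulNr) opprK subr_eq0 => /eqP <-.
by rewrite addrC.
Qed.

(** With A = x_ja, B = x_jb, d = x_ab one has AB = dA - Bd; since squares vanish, ABA = -BdA and BAB
    = BdA. *)
Lemma fkx_braid j a b : j != a -> j != b -> a != b ->
  fkx j a * fkx j b * fkx j a + fkx j b * fkx j a * fkx j b = 0.
Proof.
move=> ja jb ab; rewrite (fkx_star ja jb ab) -[fkx j b * _ * _]mulrA.
rewrite (fkx_star ja jb ab) mulrBr mulrBl -!mulrA fkx_sq // mulr0 sub0r.
by rewrite !mulrA fkx_sq // mul0r subr0 addNr.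
Qed.

(* With d = x_ab one has ab = da - bd and dc = cd, so the sum telescopes to   *)
(* d (aca + cac) - (bcb + cbc) d.                                            *)
Lemma fkx_claw j a b c : j != a -> j != b -> j != c ->
  a != b -> b != c -> a != c ->
  fkx j a * fkx j b * fkx j c * fkx j a + fkx j b * fkx j c * fkx j a * fkx j b
  + fkx j c * fkx j a * fkx j b * fkx j c = 0.
Proof.
move=> ja jb jc ab bc ac.
have dc : fkx a b * fkx j c = fkx j c * fkx a b.
  by apply: fkx_comm; rewrite // eq_sym.
have B1 := fkx_braid ja jc ac; have B2 := fkx_braid jb jc bc.
have S := fkx_star ja jb ab.
move: (fkx j a) (fkx j b) (fkx j c) (fkx a b) dc B1 B2 S => A B C d dc B1 B2 S.
have -> : A * B * C * A = d * (A * C * A) - B * C * d * A.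
  by rewrite S !mulrBl -(mulrA B d C) dc !mulrA.
have -> : B * C * A * B = B * C * d * A - B * C * B * d.
  by rewrite -mulrA S mulrBr !mulrA.
have -> : C * A * B * C = d * (C * A * C) - C * B * C * d.
  by rewrite -(mulrA C) S mulrBr mulrBl !mulrA -dc -(mulrA _ d C) dc !mulrA.
rewrite [X in X + _]addrA subrK addrACA -mulrDr B1 mulr0 add0r -opprD -mulrDl B2 mul0r.
exact: oppr0.
Qed.

Definition other (G : rel 'I_n) (j : 'I_n) (e : edgesym G) :=
  if (val e).1 == j then (val e).2 else (val e).1.

Lemma other_neq (G : rel 'I_n) j (e : edgesym G) : incident j e -> j != other j e.
Proof.
rewrite /incident /other; case: eqP => [<- _|_ /= /eqP <-]; first exact: esym_neq.
by rewrite eq_sym esym_neq.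
Qed.

Lemma other_inj (G : rel 'I_n) j (e f : edgesym G) :
  incident j e -> incident j f -> e != f -> other j e != other j f.
Proof.
rewrite /incident /other => ie jf; apply: contra => /eqP.
move: e f ie jf => [[e1 e2] /= pe] [[f1 f2] /= pf].
have /andP[le _] := pe; have /andP[lf _] := pf.
case: (e1 =P j) => [ej|_]; case: (f1 =P j) => [fj|_] /=.
- by move=> _ _ ef; apply/eqP/val_inj; rewrite /= ej fj ef.
- by move=> _ /eqP f2j ef; rewrite /= ej ef -f2j ltnNge ltnW in le.
- by move=> /eqP e2j _ ef; rewrite /= ef e2j -fj ltnNge ltnW in le.
- by move=> /eqP e2j /eqP f2j ef; apply/eqP/val_inj; rewrite /= e2j f2j ef.
Qed.

Lemma Xfrom_fkx (G : rel 'I_n) j (e : edgesym G) :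
  incident j e ->
  ncpi (ncmap (@esym_gen n G) (Xfrom j e)) = fkx j (other j e).
Proof.
rewrite /incident /Xfrom /other; case: eqP => [<- _|_ /= /eqP <-].
  by rewrite -(fkxE (esym_gen e)).
rewrite (fkx_anti (esym_neq e)) -(fkxE (esym_gen e)) -ncpi_opp.
by [].
Qed.

Lemma graph_rel_fk (G : rel 'I_n) (r : ncpoly (edgesym G)) :
  graph_rel r -> ncpi (ncmap (@esym_gen n G) r) = 0.
Proof.
have xfromE := @Xfrom_fkx G.
case=> [[e ->]|[[e [f [dis ->]]]|[]]].
- by rewrite ncmap_mul ncpi_mul -[ncmap _ _]/(ncX (esym_gen e)) fkxE fkx_sq ?esym_neq.
- rewrite ncmap_sub !ncmap_mul ncpi_sub !ncpi_mul.
  rewrite -[ncmap _ (ncX e)]/(ncX (esym_gen e)) -[ncmap _ _]/(ncX (esym_gen f)).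
  have := dis (val e).1; have := dis (val e).2; rewrite /incident !eqxx orbT /=.
  rewrite !negb_or => /andP[n1 n2] /andP[n3 n4].
  by rewrite !fkxE fkx_comm ?subrr ?esym_neq 1?eq_sym.
- move=> [j [e [f [ef ie jf ->]]]].
  rewrite ncmap_add !ncmap_mul ncpi_add !ncpi_mul !xfromE //.
  by apply: fkx_braid; rewrite ?other_neq ?other_inj.
- move=> [j [e [f [g [/and3P[ef fg eg] ie jf jg ->]]]]].
  rewrite !ncmap_add !ncmap_mul !ncpi_add !ncpi_mul !xfromE //.
  by apply: fkx_claw; rewrite ?other_neq ?other_inj.
Qed.

Lemma graph_ideal_fk (G : rel 'I_n) (p : ncpoly (edgesym G)) :
  in_ideal (@graph_rel n G) p -> in_ideal (@fk_rel n) (ncmap (@esym_gen n G) p).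
Proof.
elim=> {p} [r /graph_rel_fk /ncpi_eq0 //||p q _ Ip _ Iq|a p _ Ip|p a _ Ip|p q pq _ Ip].
- exact: ideal_0.
- by rewrite ncmap_add; apply: ideal_add.
- by rewrite ncmap_mul; apply: ideal_lmul.
- by rewrite ncmap_mul; apply: ideal_rmul.
- exact: ideal_eq (ncmap_nceq _ pq) Ip.
Qed.

End FominKirillov.

(** * Normal words and spanning *)

(* Words are over edge numbers; reps i are the module generators involving    *)
(* the edges 0, ..., i+1, and nwords i, over the edges k < nletters i, will   *)
(* give a basis for the tree on i+2 vertices.  The case i = 0 is degenerate:  *)
(* reps 0 is the whole nil-Coxeter basis for the path on 3 vertices.          *)
Fixpoint top i : seq nat :=
  if i is i'.+1 then i'.+2 :: rcons (top i') i'.+2 else [:: 0; 1; 0].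

Fixpoint reps i : seq (seq nat) :=
  if i is i'.+1 then [::] :: rcons (map (cons i'.+2) (reps i')) (top i'.+1)
  else [:: [::]; [:: 0]; [:: 1]; [:: 0; 1]; [:: 1; 0]; [:: 0; 1; 0]].

Fixpoint nwords i : seq (seq nat) :=
  if i is i'.+1 then [seq b ++ r | b <- nwords i', r <- reps i'] else [:: [::]].

(** The value at 0 is 0 rather than 1 because [reps 0] brings in the edges 0 and 1 together; the
    words of [reps i] use exactly the letters below [nletters i.+1]. *)
Definition nletters i := if i is i'.+1 then i'.+2 else 0.

Lemma top_in_reps i : top i \in reps i.
Proof. by case: i => // i; rewrite /= in_cons mem_rcons in_cons eqxx orbT. Qed.

Lemma repsSP i r : r \in reps i.+1 ->
  [\/ r = [::], (exists2 r', r' \in reps i & r = i.+2 :: r') | r = top i.+1].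
Proof.
rewrite [reps _]/= in_cons mem_rcons in_cons => /or3P[/eqP ->|/eqP ->|/mapP[r' r'i ->]].
- by constructor 1.
- by constructor 3.
- by constructor 2; exists r'.
Qed.

Lemma nil_in_reps i : [::] \in reps i.
Proof. by case: i. Qed.

Lemma cons_in_reps i r : r \in reps i -> i.+2 :: r \in reps i.+1.
Proof. by move=> ri; rewrite /= !in_cons mem_rcons in_cons map_f ?orbT. Qed.

Lemma all_top i : all (fun k => k < i.+2) (top i).
Proof.
elim: i => //= i IH; rewrite all_rcons /= !ltnSn /=.
by apply: sub_all IH => k; apply: ltnW.
Qed.

Lemma all_reps i r : r \in reps i -> all (fun k => k < i.+2) r.
Proof.
elim: i r => [|i IH] r; first by rewrite !inE => /or4P[||| /or3P[]] /eqP ->.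
case/repsSP=> [->|[r' /IH ar ->]|->] //; last exact: all_top.
by rewrite /= ltnSn; apply: sub_all ar => k; apply: ltnW.
Qed.

Lemma all_nwords i w : w \in nwords i -> all (fun k => k < nletters i) w.
Proof.
elim: i w => [|i IH] w; first by rewrite inE => /eqP ->.
case/allpairsP=> -[b r] /= [/IH ab /all_reps ar ->]; rewrite all_cat ar andbT.
by apply: sub_all ab => k; case: (i) => //= m; apply: leqW.
Qed.

Lemma size_top i : size (top i) = i.*2.+3.
Proof. by elim: i => //= i IH; rewrite size_rcons IH. Qed.

Section Spanning.
Local Open Scope ring_scope.
Variables (A : pzRingType) (X : nat -> A).

(** The graph relations have coefficients 1 and -1, so additive subgroups suffice and the rewriting
    takes place in a bare ring. *)
Inductive zspan (S : A -> Prop) : A -> Prop :=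
| zspan_in x : S x -> zspan S x
| zspan0 : zspan S 0
| zspanD x y : zspan S x -> zspan S y -> zspan S (x + y)
| zspanN x : zspan S x -> zspan S (- x).

Lemma zspan_morph (S S' : A -> Prop) (f : A -> A) :
  f 0 = 0 -> {morph f : x y / x + y} -> {morph f : x / - x} ->
  (forall x, S x -> zspan S' (f x)) -> forall x, zspan S x -> zspan S' (f x).
Proof.
move=> f0 fD fN fS x; elim=> {x} [x /fS //||x y _ IHx _ IHy|x _ IHx].
- by rewrite f0; apply: zspan0.
- by rewrite fD; apply: zspanD.
- by rewrite fN; apply: zspanN.
Qed.

Lemma zspan_sub (S S' : A -> Prop) :
  (forall x, S x -> zspan S' x) -> forall x, zspan S x -> zspan S' x.
Proof. exact: (@zspan_morph S S' id). Qed.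

Lemma zspan_mull (S S' : A -> Prop) a :
  (forall x, S x -> zspan S' (a * x)) -> forall x, zspan S x -> zspan S' (a * x).
Proof.
by apply: (@zspan_morph S S' ( *%R a)); [exact: mulr0|exact: mulrDr|exact: mulrN].
Qed.

Lemma zspan_mulr (S S' : A -> Prop) a :
  (forall x, S x -> zspan S' (x * a)) -> forall x, zspan S x -> zspan S' (x * a).
Proof.
apply: (@zspan_morph S S' (fun x => x * a)); first exact: mul0r.
  by move=> x y; exact: mulrDl.
by move=> x; exact: mulNr.
Qed.

Hypothesis X_sq : forall k, X k * X k = 0.
Hypothesis X_comm : forall j k, (j.+1 < k)%N -> (2 < k)%N -> X j * X k = X k * X j.
Hypothesis X_braid : forall k, (2 <= k)%N ->
  X k * X k.+1 * X k = X k.+1 * X k * X k.+1.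
Hypothesis X_braid0 : forall j k, (j < 3)%N -> (k < 3)%N -> j != k ->
  X j * X k * X j = - (X k * X j * X k).
Hypothesis X_claw : forall j k, (j < 2)%N -> (k < 2)%N -> j != k ->
  X 2 * X j * X k * X 2 = - (X j * X k * X 2 * X j + X k * X 2 * X j * X k).

Definition wprod w : A := \prod_(k <- w) X k.

Lemma wprod_cat v w : wprod (v ++ w) = wprod v * wprod w.
Proof. exact: big_cat. Qed.
Lemma wprod_cons k w : wprod (k :: w) = X k * wprod w.
Proof. exact: big_cons. Qed.
Lemma wprod_rcons k w : wprod (rcons w k) = wprod w * X k.
Proof. by rewrite -cats1 wprod_cat /wprod big_seq1. Qed.

Lemma wprod_comm k w : (2 < k)%N -> all (fun j => j.+1 < k)%N w ->
  wprod w * X k = X k * wprod w.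
Proof.
move=> k2; elim: w => [|j w IH] /=; first by rewrite /wprod big_nil mul1r mulr1.
case/andP=> jk /IH e; rewrite wprod_cons -mulrA e !mulrA.
by rewrite X_comm.
Qed.

Lemma wprod_topS i :
  wprod (top i.+1) = X i.+2 * wprod (top i) * X i.+2.
Proof. by rewrite [top _]/= wprod_cons wprod_rcons mulrA. Qed.

(** Write w = 2aba2. Braiding the final a2a gives wa = -(2ab2)a2; the claw relation expands 2ab2,
    one term dies on aa, and the other is b2aba2 = bw. *)
Lemma claw_twist a b : (a < 2)%N -> (b < 2)%N -> a != b ->
  X 2 * (X a * X b * X a) * X 2 * X a = X b * (X 2 * (X a * X b * X a) * X 2).
Proof.
move=> a2 b2 ab.
have -> : X 2 * (X a * X b * X a) * X 2 * X a = X 2 * X a * X b * (X a * X 2 * X a).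
  by rewrite !mulrA.
rewrite X_braid0 ?(leq_trans a2) ?neq_ltn ?a2 // mulrN.
have -> : X 2 * X a * X b * (X 2 * X a * X 2) = X 2 * X a * X b * X 2 * (X a * X 2).
  by rewrite !mulrA.
rewrite X_claw // mulNr opprK mulrDl !mulrA -(mulrA _ (X a) (X a)) X_sq.
by rewrite mulr0 mul0r add0r.
Qed.

Lemma wprod_top1 j : (j < 2)%N ->
  wprod (top 1) * X j = X (1 - j) * wprod (top 1).
Proof.
have -> : wprod (top 1) = X 2 * (X 0 * X 1 * X 0) * X 2.
  by rewrite wprod_topS /wprod !big_cons big_nil mulr1 !mulrA.
case: j => [|[|//]] _; first exact: claw_twist.
by rewrite X_braid0 // !(mulrN, mulNr) claw_twist.
Qed.

(** The k found is 1 - j for j < 2 and j itself otherwise: the longest word acts as a diagram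
    automorphism of the claw with its tail. This lets letters to its right be moved into the left
    coefficients. *)
Lemma wprod_top i j : (j < i.+2)%N -> exists2 k, (k < i.+2)%N &
  wprod (top i.+1) * X j = X k * wprod (top i.+1).
Proof.
elim: i j => [|i IH] j ji; first by exists (1 - j)%N; [lia|exact: wprod_top1].
rewrite wprod_topS; move: ji; rewrite ltnS leq_eqVlt => /predU1P[->|ji].
  exists i.+2 => //; rewrite wprod_topS.
  have c := wprod_comm (isT : 2 < i.+3)%N (all_top i).
  set P := wprod (top i) in c *.
  have -> : X i.+3 * (X i.+2 * P * X i.+2) * X i.+3 * X i.+2
          = X i.+3 * X i.+2 * P * (X i.+2 * X i.+3 * X i.+2) by rewrite !mulrA.
  (* For j = i+2: braid on the right, carry i+3 across P, whose letters are all below i+2, then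
     braid on the left. *)
  rewrite X_braid //.
  have -> : X i.+3 * X i.+2 * P * (X i.+3 * X i.+2 * X i.+3)
          = X i.+3 * X i.+2 * (P * X i.+3) * X i.+2 * X i.+3 by rewrite !mulrA.
  rewrite c.
  have -> : X i.+3 * X i.+2 * (X i.+3 * P) * X i.+2 * X i.+3
          = X i.+3 * X i.+2 * X i.+3 * P * X i.+2 * X i.+3 by rewrite !mulrA.
  by rewrite -X_braid // !mulrA.
have [k ki e] := IH _ ji; exists k; first exact: ltnW.
rewrite -mulrA -X_comm // mulrA -(mulrA (X i.+3)) e (mulrA (X i.+3)) -X_comm //.
by rewrite !mulrA.
Qed.

(** Elements of degree d of the left module generated by [reps i]; the coefficient word p is not yet
    in normal form. Recording d keeps the rewriting homogeneous. *)
Definition tgen i d x := exists p r,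
  [/\ all (fun k => k < nletters i)%N p, r \in reps i, (size p + size r)%N = d
    & x = wprod (p ++ r)].

Lemma tgenI i d p r : all (fun k => k < nletters i)%N p -> r \in reps i ->
  (size p + size r)%N = d -> zspan (tgen i d) (wprod (p ++ r)).
Proof. by move=> ap ri d'; apply: zspan_in; exists p, r. Qed.

Lemma wprod_mulr0 j r : (j < 2)%N -> r \in reps 0 ->
  zspan (tgen 0 (size r).+1) (wprod r * X j).
Proof.
have I s d : s \in reps 0 -> size s = d -> zspan (tgen 0 d) (wprod s).
  by move=> s0 sd; exact: (@tgenI 0 _ [::]).
have Z k s : wprod (s ++ [:: k; k]) = 0.
  by rewrite wprod_cat /wprod !big_cons big_nil mulr1 X_sq mulr0.
have E j' k s : (j' < 2)%N -> (k < 2)%N -> j' != k ->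
    wprod (s ++ [:: j'; k; j']) = - wprod (s ++ [:: k; j'; k]).
  move=> j2 k2 jk; rewrite !wprod_cat /wprod !big_cons !big_nil !mulr1 !mulrA.
  by rewrite -mulrA -!mulrA 2![X _ * (X _ * X _)]mulrA X_braid0 ?mulrN // ltnW.
have Z2 k j' : (j' < 2)%N -> (k < 2)%N -> j' != k -> wprod [:: j'; k; j'; k] = 0.
  move=> j2 k2 jk; rewrite (wprod_cat [:: j'; k; j'] [:: k]) (E _ _ [::]) // mulNr.
  by rewrite -wprod_cat (Z k [:: k; j']) oppr0.
move=> j2; rewrite -wprod_rcons !inE => /or4P[||| /or3P[]] /eqP ->.
all: case: j j2 => [|[|//]] _ /=.
- exact: I.
- exact: I.
- by rewrite (Z 0 [::]); exact: zspan0.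
- exact: I.
- exact: I.
- by rewrite (Z 1 [::]); exact: zspan0.
- exact: I.
- by rewrite (Z 1 [:: 0]); exact: zspan0.
- by rewrite (Z 0 [:: 1]); exact: zspan0.
- by rewrite (E 1 0 [::]) //; apply: zspanN; apply: I.
- by rewrite (Z 0 [:: 0; 1]); exact: zspan0.
- by rewrite Z2 //; exact: zspan0.
Qed.

Lemma wprod_cons_comm i p r : all (fun k => k < nletters i)%N p ->
  X i.+2 * wprod (p ++ r) = wprod (p ++ i.+2 :: r).
Proof.
rewrite !wprod_cat wprod_cons mulrA [RHS]mulrA => ap; congr (_ * _).
case: i ap => [|i] ap; last by rewrite wprod_comm.
by case: p ap => //= _; rewrite /wprod big_nil mulr1 mul1r.
Qed.

(** The critical case, where the newest letter is repeated around r. At the claw, braid and claw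
    relations remove 202, 212, 2012 and 2102. Further out, either a braid relation moves a letter to
    the left, or r is the longest word and the next longest word appears. *)
Lemma wprod_mulr_same i r : r \in reps i ->
  zspan (tgen i.+1 (size r).+2) (wprod (i.+2 :: r) * X i.+2).
Proof.
case: i => [|i].
  have J p s d : all (fun k => k < 2)%N p -> s \in reps 1 -> (size p + size s)%N = d ->
      zspan (tgen 1 d) (wprod p * wprod s).
    by move=> ap s1 <-; rewrite -wprod_cat; apply: tgenI.
  have f1 k : (k < 2)%N -> wprod [:: 2; k] * X 2 = - (wprod [:: k] * wprod [:: 2; k]).
    by case: k => [|[|//]] _; rewrite /wprod !big_cons big_nil !mulr1 X_braid0 ?mulrA.
  have f2 j k : (j < 2)%N -> (k < 2)%N -> j != k -> wprod [:: 2; j; k] * X 2 =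
     - (wprod [:: j; k] * wprod [:: 2; j] + wprod [:: k] * wprod [:: 2; j; k]).
    by move=> j2 k2 jk; rewrite /wprod !big_cons big_nil !mulr1 !mulrA X_claw.
  rewrite !inE => /or4P[||| /or3P[]] /eqP ->.
  - by rewrite /wprod big_seq1 X_sq; exact: zspan0.
  - by rewrite f1 //; apply/zspanN/J.
  - by rewrite f1 //; apply/zspanN/J.
  - by rewrite f2 //; apply/zspanN/zspanD; apply: J.
  - by rewrite f2 //; apply/zspanN/zspanD; apply: J.
  - by rewrite -wprod_rcons; apply: (@tgenI 1 _ [::]).
case/repsSP=> [->|[r' r'i ->]|->].
- by rewrite /wprod big_seq1 X_sq; exact: zspan0.
- have -> : wprod [:: i.+3, i.+2 & r'] * X i.+3 = wprod ([:: i.+2] ++ [:: i.+3, i.+2 & r']).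
    rewrite /= !wprod_cons -!mulrA wprod_comm ?all_reps // !mulrA.
    by rewrite -X_braid.
  by apply: tgenI; rewrite //= ?ltnSn // cons_in_reps ?cons_in_reps.
- rewrite -wprod_rcons -[rcons _ _]/(top i.+2).
  by apply: (@tgenI _ _ [::] (top i.+2)); rewrite ?top_in_reps //= !size_rcons.
Qed.

(** By the shape of r: an old letter after the empty word becomes a coefficient; after a word
    beginning with the newest letter, induction applies to the tail and the new letter passes the
    coefficients; after the longest word, [wprod_top] applies. The newest letter after the longest
    word gives a square. *)
Lemma wprod_mulr i r j : r \in reps i -> (j < i.+2)%N ->
  zspan (tgen i (size r).+1) (wprod r * X j).
Proof.
elim: i r j => [|i IH] r j; first by move=> r0 j2; apply: wprod_mulr0.
case/repsSP=> [->|[r' r'i ->]|->] ji.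
- rewrite -wprod_rcons; move: ji; rewrite ltnS leq_eqVlt => /predU1P[->|ji].
    by apply: (@tgenI _ _ [::]); rewrite ?cons_in_reps ?nil_in_reps.
  by apply: (@tgenI _ _ [:: j] [::]); rewrite ?nil_in_reps //= ji.
- move: ji; rewrite ltnS leq_eqVlt => /predU1P[->|ji].
    exact: wprod_mulr_same.
  rewrite wprod_cons -mulrA; apply: zspan_mull (IH _ _ r'i ji) => x.
  case=> [p [s [ap si e ->]]]; rewrite wprod_cons_comm //.
  apply: tgenI; rewrite ?cons_in_reps //=; last by rewrite addnS e.
  by apply: sub_all ap => k; case: (i) => //= m; apply: leqW.
- move: ji; rewrite ltnS leq_eqVlt => /predU1P[->|ji].
    by rewrite wprod_topS -mulrA X_sq mulr0; exact: zspan0.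
  have [k ki ->] := wprod_top ji; rewrite -wprod_cons.
  by apply: (@tgenI _ _ [:: k]); rewrite ?top_in_reps //= ki.
Qed.

Lemma wprod_tgen i w : all (fun k => k < nletters i.+1)%N w ->
  zspan (tgen i (size w)) (wprod w).
Proof.
elim/last_ind: w => [_|w j IH]; first by apply: (@tgenI _ _ [::] [::]); rewrite ?nil_in_reps.
rewrite all_rcons size_rcons wprod_rcons => /andP[ji /IH]; apply: zspan_mulr => x.
case=> [p [r [ap ri <- ->]]]; rewrite wprod_cat -mulrA.
apply: zspan_mull (wprod_mulr ri ji) => y [q [s [aq si e ->]]].
rewrite -wprod_cat catA; apply: tgenI => //; first by rewrite all_cat ap.
by rewrite size_cat -addnA e addnS.
Qed.

Lemma wprod_nwords i w : all (fun k => k < nletters i)%N w ->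
  zspan (fun x => exists b, [/\ b \in nwords i, size b = size w & x = wprod b])
    (wprod w).
Proof.
elim: i w => [|i IH] w.
  by case: w => // _; apply: zspan_in; exists [::]; rewrite inE.
move/wprod_tgen; apply: zspan_sub => x [p [r [ap ri <- ->]]].
rewrite wprod_cat; apply: zspan_mulr (IH _ ap) => y [b [bi <- ->]].
rewrite -wprod_cat; apply: zspan_in; exists (b ++ r); split=> //.
  exact: allpairs_f.
by rewrite size_cat.
Qed.

End Spanning.

(** * Twisted derivations *)

Definition swp (a b c : nat) := if c == a then b else if c == b then a else c.

Lemma swp_inj a b : injective (swp a b).
Proof. by apply: can_inj (swp a b) _ => c; rewrite /swp; do !case: eqP; congruence. Qed.

Lemma swpL a b : swp a b a = b.
Proof. by rewrite /swp eqxx. Qed.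

Lemma swpC a b c : swp a b c = swp b a c.
Proof. by rewrite /swp; do !case: eqP; congruence. Qed.

Lemma swpR a b : swp a b b = a.
Proof. by rewrite swpC swpL. Qed.

Lemma swpD a b c : c != a -> c != b -> swp a b c = c.
Proof. by rewrite /swp => /negPf -> /negPf ->. Qed.

Definition act (g : nat -> nat) (x : nat * nat) := (g x.1, g x.2).
Local Notation sact p := (act (swp p.1 p.2)).

Lemma act_swp g a b x : injective g ->
  act (swp (g a) (g b)) (act g x) = act g (act (swp a b) x).
Proof.
move=> gI; rewrite /act /swp /= !(inj_eq gI).
by congr (_, _); case: eqP => // _; case: eqP.
Qed.

Section Operators.
Local Open Scope ring_scope.
Implicit Types (p x y : nat * nat) (L M W : seq (nat * nat)).
Implicit Types (phi psi : seq (nat * nat) -> rat).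

Definition pairing p x : rat := (p == x)%:R - (p == (x.2, x.1))%:R.

(* The transpose of left multiplication by x_ij on E_n, in terms of the      *)
(* twisted derivations D_ab (x w) = <ab, x> w + (s_ab x) D_ab w.             *)
Fixpoint op x phi L : rat :=
  if L is p :: L' then
    pairing p x * phi L' + op (sact p x) (fun M => phi (p :: M)) L'
  else 0.

Definition opw (w : seq (nat * nat)) phi := foldr op phi w.
Definition counit L : rat := (L == [::])%:R.
(** The constant term left after applying to w the derivations listed in L, first entry first;
    [counit] plays this role for the element 1. *)
Definition dualw w := opw w counit.

Lemma op_ext_all (P : pred (nat * nat)) x phi psi L :
  (forall M, all P M -> phi M = psi M) -> all P L -> op x phi L = op x psi L.
Proof.
elim: L x phi psi => //= p L IH x phi psi e /andP[Pp PL]; rewrite e //.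
by congr (_ + _); apply: IH => // M PM; rewrite e //= Pp.
Qed.

Lemma op_ext x phi psi L : phi =1 psi -> op x phi L = op x psi L.
Proof. by move=> e; apply: (@op_ext_all predT) => //; apply/allP. Qed.

Lemma opw_ext w phi psi L : phi =1 psi -> opw w phi L = opw w psi L.
Proof. by move=> e; elim: w L => //= x w IH L; apply: op_ext. Qed.

Lemma op_linear x a phi psi L :
  op x (fun M => a * phi M + psi M) L = a * op x phi L + op x psi L.
Proof. by elim: L x phi psi => [|p L IH] x phi psi /=; rewrite ?IH; ring. Qed.

Lemma op0 x L : op x (fun=> 0) L = 0.
Proof. by elim: L x => //= p L IH x; rewrite IH mulr0 addr0. Qed.

Lemma opZ x a phi L : op x (fun M => a * phi M) L = a * op x phi L.
Proof.
rewrite -[RHS]addr0 -(op0 x L) -op_linear.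
by apply: op_ext => M; rewrite addr0.
Qed.

Lemma op_sum (I : Type) (s : seq I) (a : I -> rat) (f : I -> seq (nat * nat) -> rat) x L :
  op x (fun M => \sum_(i <- s) a i * f i M) L = \sum_(i <- s) a i * op x (f i) L.
Proof.
elim: s => [|i s IH]; last first.
  rewrite big_cons -IH -op_linear; apply: op_ext => M; exact: big_cons.
rewrite big_nil -[RHS](op0 x L); apply: op_ext => M; exact: big_nil.
Qed.

Lemma opw_sum (I : Type) (s : seq I) (a : I -> rat) (f : I -> seq (nat * nat) -> rat) w L :
  opw w (fun M => \sum_(i <- s) a i * f i M) L = \sum_(i <- s) a i * opw w (f i) L.
Proof.
by elim: w L => //= x w IH L; rewrite -op_sum; apply: op_ext.
Qed.

Lemma opwZ w a phi L : opw w (fun M => a * phi M) L = a * opw w phi L.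
Proof. by elim: w L => //= x w IH L; rewrite -opZ; apply: op_ext. Qed.

Lemma opw0 w L : opw w (fun=> 0) L = 0.
Proof.
by rewrite -[RHS](mul0r (opw w counit L)) -opwZ; apply: opw_ext => M; rewrite mul0r.
Qed.

Lemma opw_cat v w phi : opw (v ++ w) phi = opw v (opw w phi).
Proof. exact: foldr_cat. Qed.

Lemma op_op x y phi p L :
  op x (op y phi) (p :: L) = pairing p x * op y phi L
    + pairing p y * op (sact p x) phi L
    + op (sact p x) (op (sact p y) (fun M => phi (p :: M))) L.
Proof. by rewrite /= -addrA -op_linear. Qed.

Lemma pairing_anti p x : pairing p (x.2, x.1) = - pairing p x.
Proof. by rewrite /pairing -surjective_pairing opprB. Qed.

Lemma op_anti x phi L : op (x.2, x.1) phi L = - op x phi L.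
Proof.
elim: L x phi => [|p L IH] x phi /=; first by rewrite oppr0.
by rewrite (IH (sact p x)) pairing_anti; ring.
Qed.

Lemma pairing_eq0 p x (c : rat) :
  (p = x -> c = 0) -> (p = (x.2, x.1) -> c = 0) -> pairing p x * c = 0.
Proof.
rewrite /pairing => h1 h2; case: eqP => [/h1 ->|_]; first by rewrite mulr0.
by case: eqP => [/h2 ->|_]; rewrite ?mulr0 // subrr mul0r.
Qed.

Lemma op_sq x phi L : op x (op x phi) L = 0.
Proof.
elim: L x phi => // p L IH x phi; rewrite op_op IH addr0 -mulrDr.
by apply: pairing_eq0 => ->; rewrite /act /= swpL swpR op_anti subrr.
Qed.

Lemma op_comm x y phi L :
  x.1 != y.1 -> x.1 != y.2 -> x.2 != y.1 -> x.2 != y.2 ->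
  op x (op y phi) L = op y (op x phi) L.
Proof.
elim: L x y phi => // p L IH x y phi xy11 xy12 xy21 xy22; apply/eqP.
rewrite -subr_eq0 !op_op (IH (sact p x)) /= ?(inj_eq (@swp_inj _ _)) //.
have fixd u v : u.1 != v.1 -> u.1 != v.2 -> u.2 != v.1 -> u.2 != v.2 ->
    pairing p u * (op v phi L - op (sact p v) phi L) = 0.
  move=> uv11 uv12 uv21 uv22; apply: pairing_eq0 => ->; rewrite /act /=;
  by rewrite !swpD 1?eq_sym // -surjective_pairing subrr.
have e1 := fixd _ _ xy11 xy12 xy21 xy22.
have e2 : pairing p y * (op x phi L - op (sact p x) phi L) = 0.
  by apply: fixd; rewrite eq_sym.
by apply/eqP; lra.
Qed.

Lemma op_triangle i j k phi L : i != j -> j != k -> k != i ->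
  op (i, j) (op (j, k) phi) L + op (j, k) (op (k, i) phi) L
  + op (k, i) (op (i, j) phi) L = 0.
Proof.
elim: L i j k phi => [|p L IH] i j k phi ij jk ki; first by rewrite /= !addr0.
rewrite !op_op /=.
have e := IH _ _ _ (fun M => phi (p :: M)) .
have := e (swp p.1 p.2 i) (swp p.1 p.2 j) (swp p.1 p.2 k).
rewrite !(inj_eq (@swp_inj _ _)) => /(_ ij jk ki) {}e.
(* The contraction terms cancel in pairs: if p is (a,b) or (b,a), then s_p sends (c,a) to (c,b), and
   [op] is antisymmetric. *)
have red a b c : a != b -> b != c -> c != a ->
    pairing p (a, b) * (op (b, c) phi L + op (sact p (c, a)) phi L) = 0.
  move=> ab bc ca; apply: pairing_eq0 => ->; rewrite /act /=.
    by rewrite swpL swpD ?[c == b]eq_sym // (op_anti (b, c)) subrr.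
  by rewrite swpR swpD ?[c == b]eq_sym // (op_anti (b, c)) subrr.
have := red _ _ _ ij jk ki; have := red _ _ _ jk ki ij; have := red _ _ _ ki ij jk.
by rewrite /act /= in e *; lra.
Qed.

Definition avoids (a : nat) : pred (nat * nat) := fun x => (x.1 != a) && (x.2 != a).

Lemma pairing_avoids a p x : avoids a x -> ~~ avoids a p -> pairing p x = 0.
Proof.
rewrite /pairing /avoids => ax np; case: eqP => [e|_]; first by rewrite e ax in np.
by case: eqP => [e|_]; [rewrite e andbC ax in np|rewrite subrr].
Qed.

Lemma opw_avoids a b w phi L : all (avoids a) w ->
  opw w phi ((a, b) :: L) =
  opw (map (sact (a, b)) w) (fun M => phi ((a, b) :: M)) L.
Proof.
elim: w L => //= x w IH L /andP[ax /IH e].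
rewrite (pairing_avoids ax) ?mul0r ?add0r; first exact: op_ext.
by rewrite /avoids /= eqxx.
Qed.

Lemma opw_avoids0 a b w phi L : all (avoids a) w ->
  (forall M, phi ((a, b) :: M) = 0) -> opw w phi ((a, b) :: L) = 0.
Proof.
move=> aw e; rewrite opw_avoids // -[RHS](opw0 (map (sact (a, b)) w) L).
exact: opw_ext.
Qed.

Lemma op_act g x phi L : injective g ->
  op (act g x) phi (map (act g) L) = op x (fun M => phi (map (act g) M)) L.
Proof.
move=> gI; elim: L x phi => //= p L IH x phi; rewrite act_swp // IH.
have agI : injective (act g) by move=> [? ?] [? ?] [/gI -> /gI ->].
by rewrite /pairing (inj_eq agI) -[(_, _)]/(act g (x.2, x.1)) (inj_eq agI).
Qed.

Lemma opw_act g w phi L : injective g ->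
  opw (map (act g) w) phi (map (act g) L) = opw w (fun M => phi (map (act g) M)) L.
Proof.
by move=> gI; elim: w L => //= x w IH L; rewrite op_act //; apply: op_ext.
Qed.

Lemma dualw_act g w L : injective g ->
  dualw (map (act g) w) (map (act g) L) = dualw w L.
Proof. by move=> gI; rewrite /dualw opw_act //; apply: opw_ext => -[]. Qed.

Lemma opw_size w phi d L :
  (forall M, size M <> d -> phi M = 0) -> size L <> (size w + d)%N -> opw w phi L = 0.
Proof.
move=> phi0; elim: w L => //= x w IH; set psi := opw w phi in IH *.
move: IH; rewrite addSn; move: (size w + d)%N psi => {phi0} m psi.
move=> psi0 L; elim: L x psi m psi0 => //= p L IH x psi m psi0 Lm.
rewrite psi0; last by move=> e; apply: Lm; rewrite e.
rewrite mulr0 add0r; case: m psi0 Lm => [|m] psi0 Lm.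
  by rewrite -[RHS](op0 (sact p x) L); apply: op_ext => M; rewrite psi0.
apply: IH => [M Mm|Lm']; last by rewrite Lm' in Lm.
by apply: psi0 => -[].
Qed.

Lemma dualw_size w L : size L <> size w -> dualw w L = 0.
Proof. by move=> Lw; apply: (@opw_size _ _ 0); rewrite ?addn0 // => -[]. Qed.

(* The letters of w are only moved by transpositions fixing z, so none of     *)
(* them is ever contracted with p, which involves z.                          *)
Lemma opw_rcons z w phi L p : all (avoids z) w -> all (avoids z) L -> ~~ avoids z p ->
  opw w phi (rcons L p) = opw w (fun M => phi (rcons M p)) L.
Proof.
move=> aw aL np; elim: w L aw aL => //= x w IH L /andP[ax aw] aL.
have step psi M : all (avoids z) M -> op x psi (rcons M p) = op x (fun M' => psi (rcons M' p)) M.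
  elim: M x psi ax {IH} => [|q M IHM] x' psi ax' /=.
    by rewrite (pairing_avoids ax') // mul0r addr0.
  case/andP=> /andP[q1 q2] aM; rewrite IHM //.
  by case/andP: ax' => x1 x2; rewrite /avoids /swp /=; do !case: ifP => // _; apply/andP.
rewrite step //; apply: op_ext_all (aL) => M aM; exact: IH.
Qed.

Fixpoint walk (a : nat) l := if l is b :: l' then (a, b) :: walk b l' else [::].
Fixpoint walk_act (a : nat) l : nat -> nat :=
  if l is b :: l' then walk_act b l' \o swp a b else id.

Lemma walk_act_inj a l : injective (walk_act a l).
Proof. by elim: l a => [|b l IH] a //=; apply: inj_comp => //; apply: swp_inj. Qed.

Lemma size_walk a l : size (walk a l) = size l.
Proof. by elim: l a => //= b l IH a; rewrite IH. Qed.

(** If the letters avoid a, then D_ab cannot contract with them; after applying s_ab they avoid b,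
    so the next step of the walk, which starts at b, passes through as well. The accumulated
    relabelling is [walk_act]. *)
Lemma opw_walk a l w phi L : all (avoids a) w ->
  opw w phi (walk a l ++ L) =
  opw (map (act (walk_act a l)) w) (fun M => phi (walk a l ++ M)) L.
Proof.
elim: l a w phi => [|b l IH] a w phi aw /=.
  by rewrite (@eq_map _ _ (act id) id) ?map_id // => -[].
rewrite opw_avoids // IH; first by rewrite -map_comp.
rewrite all_map; apply: sub_all aw => x /andP[x1 x2] /=.
rewrite /avoids /swp /= (negPf x1) (negPf x2).
case: (x.1 =P b) => [e1|/eqP -> //]; case: (x.2 =P b) => [e2|/eqP -> //].
- by rewrite andbb -e1 eq_sym.
- by rewrite andbT -e1 eq_sym.
- by rewrite -e2 eq_sym.
Qed.

End Operators.

(** * Linear independence of normal words *)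

Definition par k := if k <= 2 then 0 else k.
Definition letter k := (par k, k.+1).
(** The vertex where edge i+2 is attached. For i > 0 it is also the newest vertex of the tree with
    edges 0, ..., i+1, hence absent from the words of [nwords i]; for i = 0 the only such word is
    empty. *)
Definition start i := if i is i'.+1 then i'.+3 else 0.

Lemma letter_start i : letter i.+2 = (start i, i.+3).
Proof. by case: i. Qed.

Lemma start_bound i : start i < i.+3.
Proof. by case: i => //= i; lia. Qed.

Lemma letter_avoids k z : k.+1 < z -> avoids z (letter k).
Proof. by move=> kz; rewrite /avoids /letter /par /=; case: ifP => _; lia. Qed.

Lemma letters_avoid m z w : m < z -> all (fun k => k < m) w ->
  all (avoids z) (map letter w).
Proof.
move=> mz; rewrite all_map; apply: sub_all => k km /=; apply: letter_avoids.
exact: leq_ltn_trans mz.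
Qed.

Lemma walk_rcons a l b : walk a (rcons l b) = rcons (walk a l) (last a l, b).
Proof. by elim: l a => //= c l IH a; rewrite IH. Qed.

Lemma walk_avoids z a l : a != z -> all (fun b => b != z) l -> all (avoids z) (walk a l).
Proof.
by elim: l a => //= b l IH a az /andP[bz bl]; rewrite /avoids /= az bz IH.
Qed.

Lemma size_reps i r : r \in reps i -> size r <= i.*2.+3.
Proof.
elim: i r => [|i IH] r; first by rewrite !inE => /or4P[||| /or3P[]] /eqP ->.
case/repsSP=> [->|[r' /IH ri ->]|->] //=; last by rewrite size_rcons size_top.
by rewrite doubleS; apply: leq_trans (ri : _ < _.+1) _; lia.
Qed.

Lemma uniq_reps i : uniq (reps i).
Proof.
elim: i => [|i IH] //; rewrite [reps _]/=.
have cI : injective (cons i.+2) by move=> ? ? [].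
rewrite cons_uniq rcons_uniq map_inj_uniq // IH andbT mem_rcons in_cons /=.
apply/andP; split; first by apply/mapP => -[].
apply/mapP => -[r /size_reps ri [e]]; move: ri; rewrite -e size_rcons size_top.
by rewrite ltnn.
Qed.

Lemma uniq_nwords i : uniq (nwords i).
Proof.
elim: i => [|[|i] IH] //.
rewrite -[nwords _]/[seq b ++ r | b <- nwords i.+1, r <- reps i.+1].
apply: allpairs_uniq; rewrite ?uniq_reps //.
(* The letter i+2 never occurs in b and begins every nonempty r, so its first occurrence recovers
   the cut point; if r is empty, [find] returns the full length, again that of b. *)
have findE b r : b \in nwords i.+1 -> r \in reps i.+1 -> find (pred1 i.+2) (b ++ r) = size b.
  move=> /all_nwords /= ab ri; rewrite find_cat.
  have -> : has (pred1 i.+2) b = false.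
    by apply/hasP => -[k /(allP ab) /[swap] /eqP ->]; rewrite ltnn.
  case/repsSP: ri => [->|[r' _ ->]|->] /=; rewrite ?eqxx ?addn0 //.
have inP b r : (b, r) \in [seq (x, y) | x <- nwords i.+1, y <- reps i.+1] ->
    b \in nwords i.+1 /\ r \in reps i.+1.
  by case/allpairsP=> -[? ?] /= [? ? [-> ->]].
move=> [b r] [b' r'] /inP[bi ri] /inP[bi' ri'] /= e.
have sz := congr1 (find (pred1 i.+2)) e; rewrite !findE // in sz.
by move/eqP: e; rewrite eqseq_cat ?sz // => /andP[/eqP -> /eqP ->].
Qed.

Section Duality.
Local Open Scope ring_scope.

(** Vertex i+3 occurs only in the first letter, so the first step must contract with that letter;
    the sign comes from the opposite orientations. Otherwise the step passes all of r and meets the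
    counit, giving 0. *)
Lemma dualw_letter_walk i r l : all (fun k => k < i.+2)%N r ->
  dualw (map letter (i.+2 :: r)) (walk i.+3 (start i :: l))
  = - dualw (map letter r) (walk (start i) l).
Proof.
move=> ar; rewrite [map _ _]/= letter_start /dualw /=.
rewrite [X in _ + X](_ : _ = 0) ?addr0.
  by rewrite -mulN1r /pairing /= [_ == (_, start i)]xpair_eqE eqxx xpair_eqE
     [i.+3 == _]gtn_eqF ?start_bound //= eqxx sub0r.
rewrite -[RHS](op0 (sact (i.+3, start i) (start i, i.+3)) (walk (start i) l)).
apply: op_ext => M; apply: opw_avoids0 => //.
exact: letters_avoid ar.
Qed.

Lemma top_walk i : exists l, [/\ size l = size (top i),
  all (fun b => b < i.+3)%N l, last (start i) l = start i
  & dualw (map letter (top i)) (walk (start i) l) != 0].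
Proof.
elim: i => [|i [l [sl al ll nz]]]; first by exists [:: 1; 2; 0]; split=> //; vm_compute.
have szl : start i != i.+3 by rewrite neq_ltn start_bound.
exists (start i :: rcons l i.+3); split.
- by rewrite /= !size_rcons sl.
- rewrite /= all_rcons ltnSn (leq_trans (start_bound i)) //=.
  by apply: sub_all al => b; apply: leq_trans.
- by rewrite /= last_rcons.
pose x := (start i, i.+3); pose t := map letter (top i).
have at' : all (avoids i.+3) t by apply: letters_avoid (all_top i).
have -> : map letter (top i.+1) = x :: rcons t x.
  by rewrite /= map_rcons letter_start.
have -> : walk (start i.+1) (start i :: rcons l i.+3)
        = (i.+3, start i) :: rcons (walk (start i) l) x.
  by rewrite [walk _ _]/= walk_rcons ll.
have aw : all (avoids i.+3) (walk (start i) l).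
  apply: walk_avoids => //; apply: sub_all al => b bi.
  by rewrite neq_ltn bi.
have nx : ~~ avoids i.+3 x by rewrite /avoids /= eqxx andbF.
have first : dualw (rcons t x) (rcons (walk (start i) l) x) = dualw t (walk (start i) l).
  rewrite /dualw -cats1 opw_cat (opw_rcons _ at' aw nx).
  apply: opw_ext => -[|q M] /=.
    by rewrite /pairing eqxx /counit xpair_eqE [start i == _](negPf szl) subr0 mulr1 addr0.
  by apply: (@dualw_size [:: x] (q :: rcons M x)); rewrite /= size_rcons.
(* If the first step skips the first letter, it can only contract with the last letter x. The next
   step, from [start i] to b, then finds no partner, since the transposed letters of t avoid
   [start i]. *)
have second : op (sact (i.+3, start i) x)
    (fun M => dualw (rcons t x) ((i.+3, start i) :: M))
    (rcons (walk (start i) l) x) = 0.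
  have c0 M : dualw (rcons t x) ((i.+3, start i) :: M) =
      opw (map (sact (i.+3, start i)) t) (fun M' => - counit M') M.
    rewrite /dualw -cats1 opw_cat opw_avoids //; apply: opw_ext => M'.
    rewrite /= /pairing /= eqxx [_ == x]xpair_eqE [i.+3 == _]eq_sym (negPf szl) /=.
    rewrite sub0r mulN1r -[X in _ + X = _]/(op _ (fun M => 0) M') op0.
    by rewrite addr0.
  rewrite (op_ext _ _ c0).
  case: (l) sl al => [|b l']; first by rewrite size_top.
  move=> _ /andP[bi _] /=.
  have -> : sact (i.+3, start i) x = (i.+3, start i) by rewrite /act /= swpL swpR.
  have bn : b != i.+3 by rewrite neq_ltn bi.
  rewrite /pairing !xpair_eqE (negPf szl) (negPf bn) andbF subrr mul0r add0r.
  rewrite -[RHS](op0 (sact (start i, b) (i.+3, start i)) (rcons (walk b l') x)).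
  apply: op_ext => M; apply: opw_avoids0 => [|M']; last by rewrite oppr0.
  rewrite all_map; apply: sub_all at' => y /andP[y1 y2] /=.
  rewrite /avoids /swp /= (negPf y1) (negPf y2).
  by apply/andP; split; case: ifP => [_|-> //]; rewrite eq_sym.
rewrite /dualw /= -/(dualw (rcons t x)) second addr0 first.
rewrite /pairing [_ == x]xpair_eqE [i.+3 == _]eq_sym (negPf szl) /= eqxx sub0r.
by rewrite mulN1r oppr_eq0.
Qed.

(** A walk detects words of its own length only, so the content lies among generators of equal
    length. Prefixing [start i] to the walk matches prefixing the newest letter to the word, and the
    longest word is alone in its length. *)
Lemma reps_walk i r : r \in reps i -> exists l (e : rat),
  [/\ size l = size r, e != 0
   & forall r', r' \in reps i -> (size r' <= size r)%N ->
     dualw (map letter r') (walk (start i) l) = (r' == r)%:R * e].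
Proof.
elim: i r => [|i IH] r ri.
  have base l : all (fun r' => (size r' <= size r)%N ==>
      (dualw (map letter r') (walk 0 l) == (r' == r)%:R)) (reps 0) ->
      size l = size r -> exists l (e : rat),
     [/\ size l = size r, e != 0
   & forall r', r' \in reps 0 -> (size r' <= size r)%N ->
     dualw (map letter r') (walk (start 0) l) = (r' == r)%:R * e].
    move=> al sl; exists l, 1; split=> // r' r'0 s'; rewrite mulr1.
    by apply/eqP; apply: implyP (allP al _ r'0) s'.
  (* Explicit walks from the centre for the six nil-Coxeter words, each checked by computation. *)
  move: ri base; rewrite !inE => /or4P[||| /or3P[]] /eqP ->.
  - by move/(_ [::]); apply; vm_compute.
  - by move/(_ [:: 1]); apply; vm_compute.
  - by move/(_ [:: 2]); apply; vm_compute.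
  - by move/(_ [:: 2; 1]); apply; vm_compute.
  - by move/(_ [:: 1; 2]); apply; vm_compute.
  - by move/(_ [:: 1; 2; 0]); apply; vm_compute.
case/repsSP: ri => [->|[r1 r1i ->]|->].
- exists [::], 1; split=> // r' _; rewrite leqn0 size_eq0 => /eqP ->.
  by rewrite mulr1.
- have [l [e [sl e0 H]]] := IH _ r1i.
  exists (start i :: l), (- e); split; rewrite ?oppr_eq0 //= ?sl // => r'.
  case/repsSP=> [->|[r2 r2i ->]|->] sr.
  + by rewrite mul0r.
  + by rewrite dualw_letter_walk ?all_reps // H // eqseq_cons eqxx mulrN.
  + by have := size_reps r1i; rewrite size_top doubleS /= in sr *; lia.
- have [l [sl _ _ nz]] := top_walk i.+1.
  exists l, (dualw (map letter (top i.+1)) (walk (start i.+1) l)); split=> //.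
  move=> r' r'i _; case: (r' =P top i.+1) => [->|ne]; first by rewrite mul1r.
  rewrite mul0r dualw_size // size_walk size_map sl => e; apply: ne.
  case/repsSP: r'i e => [->|[r2 /size_reps r2i ->]|->] //.
  by rewrite size_top doubleS /= => -[e]; move: r2i; rewrite -e; lia.
Qed.

(** Downward induction on the length of r inside induction on i. Testing against the walk of r
    followed by a relabelled L removes shorter r' by degree, longer r' by induction, and the others
    by [reps_walk]; what remains is a relation among the words of [nwords i], with coefficients c (b
    ++ r) times e. *)
Lemma nwords_free i (c : seq nat -> rat) :
  (forall L, \sum_(w <- nwords i) c w * dualw (map letter w) L = 0) ->
  forall w, w \in nwords i -> c w = 0.
Proof.
elim: i c => [|i IH] c H w.
  by rewrite inE => /eqP ->; have := H [::]; rewrite big_seq1 mulr1.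
suff top_down k b r : b \in nwords i -> r \in reps i -> (i.*2.+3 < size r + k)%N ->
    c (b ++ r) = 0.
  case/allpairsP=> -[b r] /= [bi ri ->].
  (* Generators have length at most 2i+3, so with this k the length condition holds for every r. *)
  by apply: (top_down i.*2.+4) => //; rewrite addnS ltnS leq_addl.
elim: k b r => [|k IHk] b r bi ri; first by rewrite addn0 ltnNge size_reps.
rewrite addnS ltnS => rk.
have [l [e [sl e0 dl]]] := reps_walk ri.
have avoid_b b' : b' \in nwords i -> all (avoids (start i)) (map letter b').
  move/all_nwords; case: i {H IH IHk bi ri rk dl} => [|i]; first by case: b'.
  by apply: letters_avoid.
have ginj : injective (walk_act (start i) l) by apply: walk_act_inj.
set g := walk_act _ _ in ginj.
have term b' r' L : b' \in nwords i -> r' \in reps i ->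
    (* Relabelling L by g compensates for the permutation that b' undergoes while the walk passes
       through it. *)
    c (b' ++ r') * dualw (map letter (b' ++ r')) (walk (start i) l ++ map (act g) L)
    = (r' == r)%:R * (c (b' ++ r) * e * dualw (map letter b') L).
  move=> b'i r'i; case: (leqP (size r') (size r)) => [r'r|rr']; last first.
    rewrite (IHk _ _ b'i r'i) ?mul0r; last by lia.
    by case: eqP rr' => [->|_ _]; rewrite ?ltnn // mul0r.
  rewrite map_cat /dualw opw_cat opw_walk ?avoid_b // -/g.
  rewrite (@opw_ext _ _ (fun M => (r' == r)%:R * e * counit M)).
    rewrite opwZ -/(dualw _ _) dualw_act // /dualw.
    by case: (r' =P r) => [->|_] /=; ring.
  move=> M; case: M => [|q M]; first by rewrite cats0 mulr1 -dl.
  rewrite mulr0; apply: dualw_size; rewrite size_cat size_walk size_map sl /=.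
  by move=> sr; move: r'r; rewrite -sr addnS ltnNge leq_addr.
have /IH/(_ b bi)/eqP : forall L,
    \sum_(b' <- nwords i) (c (b' ++ r) * e) * dualw (map letter b') L = 0.
  move=> L; rewrite -[RHS](H (walk (start i) l ++ map (act g) L)) big_allpairs_dep.
  apply: eq_big_seq => b' b'i.
  rewrite (eq_big_seq _ (fun r' r'i => term b' r' L b'i r'i)).
  rewrite (bigD1_seq r) ?uniq_reps //= eqxx mul1r big1 ?addr0 // => r' /negPf ->.
  by rewrite mul0r.
by rewrite mulf_eq0 (negPf e0) orbF => /eqP.
Qed.

End Duality.

(** * Hilbert series of the normal words *)

Section GeneratingFunction.
Local Open Scope ring_scope.

Definition genfun (s : seq (seq nat)) : {poly int} := \sum_(w <- s) 'X^(size w).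

Lemma coef_genfun s d : (genfun s)`_d = (count (fun w => size w == d) s)%:Z.
Proof.
rewrite /genfun; elim: s => [|w s IH]; first by rewrite big_nil coef0.
by rewrite big_cons coefD IH coefXn PoszD eq_sym /=; case: eqP.
Qed.

Lemma qintS k : qint k.+1 = 1 + 'X * qint k.
Proof.
rewrite /qint big_ord_recl expr0 big_distrr; congr (_ + _).
by apply: eq_bigr => j _; rewrite /= exprS.
Qed.

Lemma qintD k m : qint (k + m) = qint k + 'X^k * qint m.
Proof.
rewrite /qint big_split_ord big_distrr; congr (_ + _).
by apply: eq_bigr => j _; rewrite /= exprD.
Qed.

(** The shape of [reps] gives the recursion P_{i+1} = 1 + t P_i + t^(2i+5), the last term being the
    longest word; the closed form satisfies it because t^(i+3) = 1 + t [i+3] - [i+3]. *)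
Lemma genfun_reps i : genfun (reps i) = qint i.+3 * (1 + 'X^(i.+1)).
Proof.
elim: i => [|i IH].
  by rewrite /genfun /reps !big_cons big_nil !qintS /qint big_ord0 /= expr0; ring.
rewrite /genfun [reps _]/= big_cons -cats1 big_cat big_seq1 big_map.
under eq_bigr => w _ do rewrite [size _]/= exprS.
rewrite -mulr_sumr -[\sum_(_ <- _) _]/(genfun (reps i)) IH.
rewrite /= size_rcons size_top -addnn.
rewrite (qintS i.+3).
have -> : 'X^((i + i).+4.+1) = 'X * 'X^(i.+1) * 'X^(i.+3) :> {poly int}.
  by rewrite -!exprS -exprD; congr ('X^ _); lia.
have : qint i.+4 = qint i.+3 + 'X^(i.+3) by rewrite -addn1 qintD /qint big_ord1 expr0 mulr1.
rewrite (qintS i.+3) => e.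
have -> : 'X^(i.+2) = 'X * 'X^(i.+1) :> {poly int} by rewrite exprS.
move: (qint i.+3) ('X^(i.+3)) e => q y e.
have -> : y = 1 + 'X * q - q by rewrite e addrC addKr.
by rewrite expr0; ring.
Qed.

Lemma genfun_nwords i : genfun (nwords i.+2) = HDn i.+4.
Proof.
have S j : genfun (nwords j.+1) = genfun (nwords j) * genfun (reps j).
  rewrite {1}/genfun big_allpairs_dep mulr_suml; apply: eq_bigr => b _.
  by rewrite mulr_sumr; apply: eq_bigr => r _; rewrite size_cat exprD.
elim: i => [|i IH].
  rewrite !S !genfun_reps /HDn /genfun big_seq1 /= big_nat1.
  rewrite !qintS /qint big_ord0; ring.
rewrite S IH genfun_reps /HDn /= (big_nat_recr i.+3) //=.
rewrite mul2n -addnn (qintD i.+3); ring.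
Qed.

End GeneratingFunction.

(** * The tree D_n *)

Section FkAction.
Local Open Scope ring_scope.
Variable n : nat.

Definition ends (a : fkgen n) : nat * nat := (val (val a).1, val (val a).2).

Lemma ends_neq a : (ends a).1 != (ends a).2.
Proof. exact: valP a. Qed.

(** Left multiplication on E_n, seen through its transposes. The induction needs all phi and L: a
    right factor is absorbed into phi, while a left factor is an operator applied to a function that
    vanishes everywhere. *)
Lemma fk_ideal_opw p phi L : in_ideal (@fk_rel n) p ->
  lin (V := rat^o) (fun w => opw (map ends w) phi L) p = 0.
Proof.
move=> Ip; elim: Ip phi L => {p} [r rel||p q _ IHp _ IHq|a p _ IH|p a _ IH|p q pq _ IH] phi L.
- case: rel => [[a [b [e1 e2 ->]]]|[[a ->]|[[a [b [h1 h2 h3 h4 ->]]]|[a [b [c [e1 e2 e3 ->]]]]]]].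
  + have eb : ends b = ((ends a).2, (ends a).1) by rewrite /ends e1 e2.
    by rewrite lin_add !lin_word /= eb op_anti addrN.
  + by rewrite lin_mul !big_seq1 /= op_sq scaler0.
  + rewrite lin_sub !lin_mul !big_seq1 /= mulr1 !scale1r op_comm ?subrr //.
  + rewrite !lin_add !lin_mul !big_seq1 /= mulr1 !scale1r.
    have ab : ends b = ((ends a).2, (ends b).2) by rewrite /ends -e1.
    have ac : ends c = ((ends b).2, (ends a).1) by rewrite /ends e2 e3.
    have := ends_neq a; have := ends_neq b; have := ends_neq c.
    rewrite ac ab /= => n1 n2 n3.
    rewrite [ends a]surjective_pairing /=.
    by apply: op_triangle.
- exact: lin0.
- by rewrite lin_add IHp IHq addr0.
- rewrite lin_mul big1 // => m _; transitivity ((m.1 : rat) * opw (map ends m.2)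
      (fun M => \sum_(m' <- p) m'.1 * opw (map ends m'.2) phi M) L).
    rewrite opw_sum mulr_sumr; apply: eq_bigr => m' _.
    by rewrite map_cat opw_cat mulrA.
  by rewrite (@opw_ext _ _ (fun=> 0)) ?opw0 ?mulr0 // => M; exact: IH.
- rewrite lin_mul exchange_big big1 // => m' _ /=.
  transitivity ((m'.1 : rat) * \sum_(m <- p) m.1 * opw (map ends m.2) (opw (map ends m'.2) phi) L).
    rewrite mulr_sumr; apply: eq_bigr => m _.
    by rewrite map_cat opw_cat mulrA [m'.1 * _]mulrC.
  by rewrite [X in _ * X]IH mulr0.
- by rewrite -(lin_nceq _ pq).
Qed.

End FkAction.

Section Combination.
Local Open Scope ring_scope.
Variables (R : pzRingType) (V : lmodType R) (I : eqType).

Lemma big_delta (s : seq I) i (h : I -> V) : uniq s -> i \in s ->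
  \sum_(b <- s) ((b == i)%:R : R) *: h b = h i.
Proof.
move=> us si; rewrite (bigD1_seq i) //= eqxx scale1r big1 ?addr0 // => b /negPf ->.
exact: scale0r.
Qed.

End Combination.

Lemma zspan_comb (F : pzRingType) (A : pzRingType) (V : lmodType F) (f : A -> V) (I : eqType)
    (s : seq I) (h : I -> V) (S : A -> Prop) : uniq s ->
  f 0%R = 0%R -> {morph f : x y / (x + y)%R} -> {morph f : x / (- x)%R} ->
  (forall x, S x -> exists2 b, b \in s & f x = h b) ->
  forall x, zspan S x -> exists c : I -> F, f x = (\sum_(b <- s) c b *: h b)%R.
Proof.
move=> us f0 fD fN hS x.
elim=> {x} [x /hS[b sb ->]||x y _ [c ec] _ [d ed]|x _ [c ec]].
- by exists (fun b' => (b' == b)%:R)%R; rewrite big_delta.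
- by exists (fun=> 0)%R; rewrite f0 big1 // => b _; exact: scale0r.
- exists (fun b => c b + d b)%R; rewrite fD ec ed -big_split.
  by apply: eq_bigr => b _; rewrite scalerDl.
- exists (fun b => - c b)%R; rewrite fN ec -sumrN.
  by apply: eq_bigr => b _; rewrite scaleNr.
Qed.

Section TreeD.
Local Open Scope ring_scope.
Variable m : nat.
Local Notation n := m.+4.
Local Notation T := (edgesym (Dn n)).
Local Notation A := (ncquot (@graph_rel n (Dn n))).
Local Notation pi := (@ncpi _ (@graph_rel n (Dn n))).

Lemma edge0_subproof : ((inord 0 : 'I_n) < (inord 1 : 'I_n))%N && Dn n (inord 0) (inord 1).
Proof. by rewrite /Dn /= !inordK. Qed.

Definition edge0 : T := exist _ (inord 0, inord 1) edge0_subproof.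

Definition edge k : T := insubd edge0 (inord (par k), inord k.+1).

Lemma val_edge k : (k < m.+3)%N -> val (edge k) = (inord (par k), inord k.+1).
Proof.
move=> km; have pm : (par k < n)%N by rewrite /par; case: ifP => // _; exact: ltnW.
rewrite /edge val_insubd /Dn /= !inordK // ifT // /Dadj /par.
by case: k {km pm} => [|[|[|k]]] //=; rewrite ltnSn eqxx.
Qed.

Definition edge_index (e : T) : nat := (val (val e).2).-1.

Lemma edge_indexP e : (edge_index e < m.+3)%N /\ edge (edge_index e) = e.
Proof.
have lt : (edge_index e < m.+3)%N.
  by rewrite /edge_index; case: (val e).2 => -[|k] //=.
split=> //; apply: val_inj; rewrite val_edge // /edge_index.
case: e lt => -[a b] /= ab; have /andP[lt] := ab; rewrite /Dn /Dadj /edge_index /= => adj bm.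
have [b' eb] : exists b', b = b'.+1 :> nat by exists b.-1; rewrite prednK // (leq_ltn_trans _ lt).
move: lt adj bm; rewrite eb /= => lt adj bm.
have <- : a = par b' :> nat.
  rewrite /par; move: adj; rewrite !inE; case: ifP; lia.
by rewrite -eb !inord_val.
Qed.

(** Zero beyond the last edge, so that the relations assumed for all indices in the spanning
    argument hold without a bound. *)
Definition edge_elt k : A := if (k < m.+3)%N then pi (ncX (edge k)) else 0.
Local Notation X := edge_elt.

Lemma edge_elt_out k : (m.+3 <= k)%N -> X k = 0.
Proof. by move=> mk; rewrite /edge_elt ltnNge mk. Qed.

Lemma par_bound k : (k < m.+3)%N -> (par k < n)%N.
Proof. by rewrite /par; case: ifP => // _ km; apply: ltnW. Qed.

Lemma inord_neq a b : (a < n)%N -> (b < n)%N -> a != b -> (inord a : 'I_n) != inord b.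
Proof. by move=> an bn; apply: contra => /eqP/(congr1 val); rewrite /= !inordK // => ->. Qed.

Lemma par_neq k : par k != k.+1.
Proof. by rewrite /par; case: ifP => _; lia. Qed.

Lemma edge_neq j k : (j < m.+3)%N -> (k < m.+3)%N -> j != k -> edge j != edge k.
Proof.
move=> jm km; apply: contra => /eqP/(congr1 (fun e => val (val e).2)).
by rewrite /= !val_edge // !inordK // => -[->].
Qed.

Lemma Xfrom_par k : (k < m.+3)%N -> pi (Xfrom (inord (par k)) (edge k)) = X k.
Proof. by move=> km; rewrite /Xfrom val_edge //= eqxx /edge_elt km. Qed.

Lemma Xfrom_succ k : (k < m.+3)%N -> pi (Xfrom (inord k.+1) (edge k)) = - X k.
Proof.
move=> km; have ne : (val (edge k)).1 != inord k.+1.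
  by rewrite val_edge //= inord_neq ?par_neq ?par_bound.
by rewrite /Xfrom (negPf ne) ncpi_opp /edge_elt km.
Qed.

Lemma incident_par k : (k < m.+3)%N -> incident (inord (par k)) (edge k).
Proof. by move=> km; rewrite /incident val_edge //= eqxx. Qed.

Lemma incident_succ k : (k < m.+3)%N -> incident (inord k.+1) (edge k).
Proof. by move=> km; rewrite /incident val_edge //= eqxx orbT. Qed.

Lemma Xfrom_center k : (k < 3)%N -> pi (Xfrom (inord 0) (edge k)) = X k.
Proof.
move=> k3; rewrite -[in RHS]Xfrom_par; last exact: leq_trans k3 _.
by rewrite /par -ltnS k3.
Qed.

Lemma incident_center k : (k < 3)%N -> incident (inord 0) (edge k).
Proof.
move=> k3; have := @incident_par k (leq_trans k3 (isT : (3 <= m.+3)%N)).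
by rewrite /par -[(k <= 2)%N]/(k < 3)%N k3.
Qed.

Lemma edge_elt_sq k : X k * X k = 0.
Proof.
have [km|km] := ltnP k m.+3; last by rewrite edge_elt_out ?mul0r.
by rewrite /edge_elt km -ncpi_mul; apply/ncpi_eq0/ideal_gen; left; exists (edge k).
Qed.

Lemma edge_elt_comm j k : (j.+1 < k)%N -> (2 < k)%N -> X j * X k = X k * X j.
Proof.
move=> jk k2; have [km|km] := ltnP k m.+3; last by rewrite [X k]edge_elt_out ?mul0r ?mulr0.
have jm : (j < m.+3)%N by lia.
rewrite /edge_elt jm km; apply/eqP; rewrite -subr_eq0 -!ncpi_mul -ncpi_sub.
apply/eqP/ncpi_eq0/ideal_gen; right; left; exists (edge j), (edge k); split=> // v.
have pk : par k = k by rewrite /par leqNgt k2.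
have pj : (par j <= j)%N by rewrite /par; case: ifP.
rewrite /incident !val_edge //= pk; apply/negP => /andP[].
by move=> /orP[] /eqP <- /orP[] /eqP/(congr1 val); rewrite /= !inordK //; lia.
Qed.

Lemma edge_elt_braid_at v (e f : T) : e != f -> incident v e -> incident v f ->
  pi (Xfrom v e) * pi (Xfrom v f) * pi (Xfrom v e) =
  - (pi (Xfrom v f) * pi (Xfrom v e) * pi (Xfrom v f)).
Proof.
move=> ef ve vf; apply/eqP; rewrite -addr_eq0 -!ncpi_mul -ncpi_add.
by apply/eqP/ncpi_eq0/ideal_gen; right; right; left; exists v, e, f.
Qed.

(** The shared vertex is the larger end of edge k but the smaller end of edge k+1; this orientation
    sign occurs twice on one side and once on the other, turning the sum relation into an
    equality. *)
Lemma edge_elt_braid k : (2 <= k)%N -> X k * X k.+1 * X k = X k.+1 * X k * X k.+1.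
Proof.
move=> k2; have [km|km] := ltnP k.+1 m.+3; last by rewrite [X k.+1]edge_elt_out ?(mul0r, mulr0).
have km' := ltnW km; have pk : par k.+1 = k.+1 by rewrite /par ltnNge k2.
have x1 := Xfrom_par km; have i1 := incident_par km; rewrite pk in x1 i1.
have ne : edge k != edge k.+1 by rewrite edge_neq // neq_ltn ltnSn.
have := edge_elt_braid_at ne (incident_succ km') i1.
by rewrite x1 (Xfrom_succ km') !(mulrN, mulNr) !opprK.
Qed.

Lemma edge_elt_braid0 j k : (j < 3)%N -> (k < 3)%N -> j != k ->
  X j * X k * X j = - (X k * X j * X k).
Proof.
move=> j3 k3 jk.
have e3 i : (i < 3)%N -> (i < m.+3)%N by move=> i3; apply: leq_trans i3 _.
rewrite -!Xfrom_center //; apply: edge_elt_braid_at.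
- by apply: edge_neq; rewrite ?e3.
- exact: incident_center.
- exact: incident_center.
Qed.

Lemma edge_elt_claw j k : (j < 2)%N -> (k < 2)%N -> j != k ->
  X 2 * X j * X k * X 2 = - (X j * X k * X 2 * X j + X k * X 2 * X j * X k).
Proof.
move=> j2 k2 jk; have [j3 k3] := (ltnW j2 : (j < 3)%N, ltnW k2 : (k < 3)%N).
have e3 i : (i < 3)%N -> (i < m.+3)%N by move=> i3; apply: leq_trans i3 _.
apply/eqP; rewrite -addr_eq0 addrA -!Xfrom_center // -!ncpi_mul -!ncpi_add.
apply/eqP/ncpi_eq0/ideal_gen; right; right; right.
exists (inord 0), (edge 2), (edge j), (edge k); split; rewrite ?incident_center //.
by rewrite !edge_neq ?e3 // neq_ltn ?j2 ?k2 orbT.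
Qed.

Lemma edge_elt_word w : pi (ncword w) = wprod X (map edge_index w).
Proof.
rewrite ncpi_word /wprod big_map; apply: eq_bigr => e _.
by have [lt {1}<-] := edge_indexP e; rewrite /edge_elt lt.
Qed.

Lemma edge_index_edge k : (k < m.+3)%N -> edge_index (edge k) = k.
Proof. by move=> km; rewrite /edge_index val_edge //= inordK. Qed.

Lemma edge_indexK b : b \in nwords m.+2 -> map edge_index (map edge b) = b.
Proof.
move=> /all_nwords ab; rewrite -map_comp -[RHS]map_id; apply/eq_in_map => k kb.
by rewrite /= edge_index_edge // (allP ab).
Qed.

Lemma nwords_span (w : seq T) : exists c : seq nat -> rat, pi (ncword w) =
  \sum_(b <- [seq b <- nwords m.+2 | size b == size w]) c b *: pi (ncword (map edge b)).
Proof.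
have ax : all (fun k => k < nletters m.+2)%N (map edge_index w).
  by rewrite all_map; apply/allP => e _; have [] := edge_indexP e.
have := wprod_nwords edge_elt_sq edge_elt_comm edge_elt_braid edge_elt_braid0 edge_elt_claw ax.
rewrite edge_elt_word size_map.
apply: (@zspan_comb rat A A id _ _ (fun b => pi (ncword (map edge b)))) => //.
  exact/filter_uniq/uniq_nwords.
move=> x [b [bi sb ->]]; exists b; first by rewrite mem_filter sb eqxx.
by rewrite edge_elt_word edge_indexK.
Qed.

Lemma nwords_span_all (p : ncpoly T) : exists c : seq nat -> rat,
  pi p = \sum_(b <- nwords m.+2) c b *: pi (ncword (map edge b)).
Proof.
rewrite ncpi_lin /lin; elim: p => [|[a w] p [c ec]].
  by exists (fun=> 0); rewrite big_nil big1 // => b _; exact: scale0r.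
have [d ed] := nwords_span w; rewrite big_cons /= ec ed big_filter.
exists (fun b => (if size b == size w then a * d b else 0) + c b).
rewrite big_mkcond scaler_sumr -big_split; apply: eq_bigr => b _ /=.
by case: ifP => _; rewrite scalerDl ?scalerA // scaler0 scale0r.
Qed.

Local Notation gen := (@esym_gen n (Dn n)).
Local Notation dual L := (fun w : seq (fkgen n) => dualw (map (@ends n) w) L : rat^o).

Lemma dual_edge b L : b \in nwords m.+2 ->
  lin (dual L) (ncmap gen (ncword (map edge b))) = dualw (map letter b) L.
Proof.
move=> /all_nwords ab; rewrite lin_word /= -!map_comp; congr dualw.
apply/eq_in_map => k /(allP ab) km.
by rewrite /= /ends /= val_edge //= !inordK ?par_bound.
Qed.

Lemma fk_ideal_dual p L : in_ideal (@fk_rel n) p -> lin (dual L) p = 0.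
Proof. exact: fk_ideal_opw. Qed.

(** Modulo the graph relations p equals a combination q of normal words. As p dies in E_n, so does
    q, and independence kills its coefficients. *)
Lemma fk_ideal_graph (p : ncpoly T) :
  in_ideal (@fk_rel n) (ncmap gen p) -> in_ideal (@graph_rel n (Dn n)) p.
Proof.
move=> fkp; apply/ncpi_eq0; have [c ec] := nwords_span_all p.
pose q := [seq (c b, map edge b) | b <- nwords m.+2].
have eq : pi p = pi q by rewrite ec [RHS]ncpi_lin /lin big_map.
have c0 : forall b, b \in nwords m.+2 -> c b = 0.
  apply: nwords_free => L.
  have /graph_ideal_fk/(fk_ideal_dual L) : in_ideal (@graph_rel n (Dn n)) (ncsub p q).
    by apply/ncpi_eq0; rewrite ncpi_sub eq subrr.
  rewrite ncmap_sub lin_sub (fk_ideal_dual L fkp) sub0r => /eqP.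
  rewrite oppr_eq0 => /eqP; rewrite lin_ncmap /lin big_map => e.
  rewrite -[RHS]e; apply: eq_big_seq => b bi; congr (_ * _).
  by rewrite -(dual_edge L bi) lin_word.
by rewrite ec big1_seq // => b /andP[_ /c0 ->]; exact: scale0r.
Qed.

Lemma dimEG_nwords d :
  dimEG (Dn n) d (count (fun b => size b == d) (nwords m.+2)).
Proof.
set s := [seq b <- nwords m.+2 | size b == d].
have us : uniq s by apply/filter_uniq/uniq_nwords.
pose bs : seq (ncpoly T) := [seq ncword (map edge b) | b <- s].
have nthE i : (i < size s)%N -> nth (nc0 T) bs i = ncword (map edge (nth [::] s i)).
  by move=> si; rewrite (nth_map [::]).
exists bs; split.
- by rewrite size_map size_filter.
- by apply/allP => _ /mapP[b + ->]; rewrite mem_filter /nchomog /= size_map andbT => /andP[].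
- move=> c fkc i; rewrite -size_filter -/s => si.
  (* Extension by zero to all normal words, to which independence applies. *)
  pose c' b := if size b == d then c (index b s) else 0.
  have in_s b : b \in s -> size b = d /\ b \in nwords m.+2.
    by rewrite mem_filter => /andP[/eqP].
  have [sd ni] := in_s _ (mem_nth [::] si).
  have <- : c' (nth [::] s i) = c i by rewrite /c' sd eqxx index_uniq.
  apply: nwords_free ni => L; rewrite -[RHS](fk_ideal_dual L fkc) lin_ncmap lin_nclin.
  transitivity (\sum_(b <- s) c (index b s) * dualw (map letter b) L).
    rewrite [RHS]big_filter [RHS]big_mkcond; apply: eq_bigr => b _; rewrite /c'.
    by case: ifP => _ //; exact: mul0r.
  rewrite (big_nth [::]) big_mkord size_map; apply: eq_bigr => j _.
  have [_ nj] := in_s _ (mem_nth [::] (ltn_ord j)).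
  by rewrite nthE // -lin_ncmap dual_edge // index_uniq.
- move=> w sw; have [c ec] := nwords_span w.
  exists (fun i => c (nth [::] s i)); apply/graph_ideal_fk/ncpi_eq0.
  rewrite ncpi_sub ec sw -/s [X in _ - X]ncpi_lin lin_nclin size_map.
  rewrite (big_nth [::]) big_mkord; apply/eqP; rewrite subr_eq0; apply/eqP.
  by apply: eq_bigr => j _; rewrite nthE // lin_word.
Qed.

End TreeD.

Theorem mainTheorem16 (n : nat) (hn : (4 <= n)%N) :
  (forall p : ncpoly (edgesym (Dn n)),
     in_ideal (@fk_rel n) (ncmap (@esym_gen n (Dn n)) p) <->
     in_ideal (@graph_rel n (Dn n)) p)
  /\ (forall d : nat, exists k : nat,
        (((HDn n)`_d)%R = (k%:Z)%R) /\ dimEG (Dn n) d k).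
Proof.
case: n hn => [|[|[|[|m]]]] // _; split=> [p|d].
  by split=> [/fk_ideal_graph|/graph_ideal_fk].
exists (count (fun b => size b == d) (nwords m.+2)).
by split; [rewrite -genfun_nwords coef_genfun|exact: dimEG_nwords].
Qed.
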